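(* Let $k$ be a field of characteristic zero, $n\geq 1$, and let $A\in k[z]^{n\times n}$ be such that $\det(A)\in k\smallsetminus\{0\}$. Then there exists a Picard-Vessiot extension of $k(z)$ for $\sigma(y)=Ay$ inside $\operatorname{Seq}_k$.
   Context: $\mathbb{N}=\{0,1,2,\ldots\}$. All rings are commutative. A $\sigma$-ring is a ring $R$ with a ring endomorphism $\sigma\colon R\to R$; morphisms of $\sigma$-rings commute with $\sigma$; a $\sigma$-field is a $\sigma$-ring that is a field; $R^\sigma=\{r\in R\mid \sigma(r)=r\}$. The field $k(z)$ is a $\sigma$-field via the automorphism $\sigma(h(z))=h(z+1)$. A $\sigma$-pseudo field is a $\sigma$-ring $L$ for which there exist orthogonal idempotents $e_0,\ldots,e_{l-1}\in L$ with $L=e_0L\oplus\cdots\oplus e_{l-1}L$, $\sigma(e_0)=e_1,\ \sigma(e_1)=e_2,\ldots,\sigma(e_{l-1})=e_0$, and each $e_iL$ a field. Let $K$ be a $\sigma$-field and $A\in\operatorname{GL}_n(K)$. A $\sigma$-pseudo field extension $L$ of $K$ is a Picard-Vessiot extension for $\sigma(y)=Ay$ if (1) there is $Y\in\operatorname{GL}_n(L)$ with $\sigma(Y)=AY$ such that $L$ is the total ring of fractions of $K[Y_{ij}]$ (written $L=K(Y_{ij})$), and (2) $L^\sigma=K^\sigma$. $\operatorname{Seq}_k$ is the ring of sequences $f\colon\mathbb{N}\to k$ modulo the identification of $f$ and $g$ if $f(i)=g(i)$ for all $i\gg 0$, with componentwise addition and multiplication, and with $\sigma(f)=(f(1),f(2),\ldots)$.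 The map $k(z)\to\operatorname{Seq}_k$, $h\mapsto(h(0),h(1),h(2),\ldots)$ (well defined since $h$ has finitely many poles) makes $\operatorname{Seq}_k$ a $k(z)$-$\sigma$-algebra. ''Inside $\operatorname{Seq}_k$'' means a $k(z)$-$\sigma$-subalgebra of $\operatorname{Seq}_k$. *)

(* Defs.v *)
From HB Require Import structures.
From mathcomp Require Import all_boot all_order all_algebra.
From mathcomp Require Import generic_quotient ring_quotient fraction.
From mathcomp Require Import boolp classical_sets functions.
From mathcomp Require Import ring.

Set Implicit Arguments.
Unset Strict Implicit.
Unset Printing Implicit Defensive.

Import GRing.Theory.
Local Open Scope ring_scope.
Local Open Scope quotient_scope.

HB.mixin Record hasSigma (R : Type) of GRing.ComNzRing R := {
  sigma : {rmorphism R -> R}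
}.

#[short(type="sigmaRingType")]
HB.structure Definition SigmaRing := {R of GRing.ComNzRing R & hasSigma R}.

#[short(type="sigmaFieldType")]
HB.structure Definition SigmaField := {R of GRing.Field R & hasSigma R}.

Definition sigma_morphism (R S : sigmaRingType) (f : {rmorphism R -> S}) :=
  forall x, f (sigma x) = sigma (f x).

Record sigmaAlg (K : sigmaRingType) := SigmaAlg {
  salg_ring :> sigmaRingType;
  salg_map : {rmorphism K -> salg_ring};
  salg_mapP : sigma_morphism salg_map
}.

Record sigmaSubalg (K : sigmaRingType) (R : sigmaAlg K) := SigmaSubalg {
  subalg_pred :> {pred R};
  subalg_subring : subring_closed subalg_pred;
  subalg_base : forall a : K, salg_map R a \in subalg_pred;
  subalg_sigma : {in subalg_pred, forall x, sigma x \in subalg_pred}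
}.

Section SubalgAsAlg.
Variables (K : sigmaRingType) (R : sigmaAlg K) (S : sigmaSubalg R).

HB.instance Definition _ :=
  GRing.isSubringClosed.Build R (subalg_pred S) (subalg_subring S).

Definition subalg_type : Type := {x : R | x \in subalg_pred S}.
HB.instance Definition _ := SubChoice.on subalg_type.
HB.instance Definition _ := [SubChoice_isSubComNzRing of subalg_type by <:].

Definition subalg_sigma_fun (x : subalg_type) : subalg_type :=
  exist _ (sigma (val x)) (subalg_sigma (valP x)).

Lemma subalg_sigma_zmod : zmod_morphism subalg_sigma_fun.
Proof. by move=> x y; apply: val_inj; rewrite /= !rmorphB. Qed.

Lemma subalg_sigma_monoid : monoid_morphism subalg_sigma_fun.
Proof. by split=> [|x y]; apply: val_inj; rewrite /= ?rmorph1 ?rmorphM. Qed.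

HB.instance Definition _ :=
  GRing.isZmodMorphism.Build subalg_type subalg_type subalg_sigma_fun
    subalg_sigma_zmod.
HB.instance Definition _ :=
  GRing.isMonoidMorphism.Build subalg_type subalg_type subalg_sigma_fun
    subalg_sigma_monoid.
HB.instance Definition _ := hasSigma.Build subalg_type subalg_sigma_fun.

Definition subalg_map (a : K) : subalg_type :=
  exist _ (salg_map R a) (subalg_base S a).

Lemma subalg_map_zmod : zmod_morphism subalg_map.
Proof. by move=> x y; apply: val_inj; rewrite /= !rmorphB. Qed.

Lemma subalg_map_monoid : monoid_morphism subalg_map.
Proof. by split=> [|x y]; apply: val_inj; rewrite /= ?rmorph1 ?rmorphM. Qed.

HB.instance Definition _ :=
  GRing.isZmodMorphism.Build K subalg_type subalg_map subalg_map_zmod.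
HB.instance Definition _ :=
  GRing.isMonoidMorphism.Build K subalg_type subalg_map subalg_map_monoid.

Lemma subalg_mapP : sigma_morphism subalg_map.
Proof. by move=> a; apply: val_inj; rewrite /= salg_mapP. Qed.

Definition subalg_alg : sigmaAlg K := SigmaAlg subalg_mapP.

End SubalgAsAlg.

Definition in_principal (R : comNzRingType) (e x : R) := exists y, x = e * y.

(* [e R] is a field, its unit element being the idempotent [e]. *)
Definition principal_field (R : comNzRingType) (e : R) :=
  e != 0 /\
  forall x, in_principal e x -> x != 0 ->
    exists2 y, in_principal e y & x * y = e.

(* [ordS] is the successor modulo [l]. *)
Definition sigma_pseudo_field (L : sigmaRingType) :=
  exists (l : nat) (e : 'I_l -> L),
    [/\ (0 < l)%N,
        (forall i, e i * e i = e i) /\ (forall i j, i != j -> e i * e j = 0),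
        forall x : L, exists! u : {ffun 'I_l -> L},
          (forall i, in_principal (e i) (u i)) /\ x = \sum_i u i,
        forall i, sigma (e i) = e (ordS i) &
        forall i, principal_field (e i)].

(* [K[y_i | i in I]]: closure under opposites follows from [adj_base (-1)]. *)
Inductive adjoin (K L : comNzRingType) (f : {rmorphism K -> L})
    (I : Type) (y : I -> L) : L -> Prop :=
  | adj_base a : adjoin f y (f a)
  | adj_gen i : adjoin f y (y i)
  | adj_add u v : adjoin f y u -> adjoin f y v -> adjoin f y (u + v)
  | adj_mul u v : adjoin f y u -> adjoin f y v -> adjoin f y (u * v).

Definition nonzerodivisor_in (L : comNzRingType) (B : L -> Prop) (s : L) :=
  B s /\ forall b, B b -> s * b = 0 -> b = 0.

(* [L] is the localization of its subring [B] at all nonzerodivisors of [B]. *)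
Definition total_fraction_ring (L : comNzRingType) (B : L -> Prop) :=
  (forall s, nonzerodivisor_in B s -> exists t, s * t = 1) /\
  (forall x, exists b s t,
    [/\ B b, nonzerodivisor_in B s, s * t = 1 & x = b * t]).

(* [GL_n] over a ring whose units need not be decidable. *)
Definition inGL (L : comNzRingType) n (Y : 'M[L]_n) :=
  exists Z : 'M[L]_n, Y *m Z = 1%:M /\ Z *m Y = 1%:M.

Definition Picard_Vessiot (K : sigmaFieldType) n (A : 'M[K]_n)
    (L : sigmaAlg K) :=
  [/\ A \in unitmx,
      sigma_pseudo_field L,
      exists Y : 'M[L]_n,
        [/\ inGL Y,
            map_mx sigma Y = map_mx (salg_map L) A *m Y &
            total_fraction_ring
              (adjoin (salg_map L) (fun ij : 'I_n * 'I_n => Y ij.1 ij.2))] &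
      forall x : L, sigma x = x <->
        exists a : K, sigma a = a /\ x = salg_map L a].

Section FractionLift.
Variables (R : idomainType) (S : comNzRingType).
Implicit Type x : {fraction R}.

Lemma frac_numden x :
  x * FracField.tofrac (\d_(repr x)) = FracField.tofrac (\n_(repr x)).
Proof.
rewrite -{1}[x]reprK; unlock FracField.tofrac.
rewrite -[LHS]FracField.pi_mul; apply/eqmodP; rewrite /= FracField.equivfE.
rewrite /FracField.mulf !numden_Ratio ?oner_eq0 ?mulr1 ?denom_ratioP //.
by rewrite mulrC.
Qed.

Variables (f : {rmorphism R -> S}) (g : R -> S) (h : {fraction R} -> S).
Hypothesis fgK : forall d, d != 0 -> f d * g d = 1.
Hypothesis hE : forall x, h x = f \n_(repr x) * g \d_(repr x).

Lemma frac_lift_cancel d u v : d != 0 -> u * f d = v * f d -> u = v.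
Proof.
move=> d0 /(congr1 ( *%R^~ (g d))) /=.
by rewrite -!mulrA fgK // !mulr1.
Qed.

Lemma frac_lift_eq x n d : d != 0 ->
  x * FracField.tofrac d = FracField.tofrac n -> h x * f d = f n.
Proof.
move=> d0 xd; rewrite hE; set n' := \n_ _; set d' := \d_ _.
have d'0 : d' != 0 by exact: denom_ratioP.
have nd : n' * d = n * d'.
  by apply/eqP; rewrite -tofrac_eq !rmorphM /= -xd -frac_numden mulrAC.
apply: (frac_lift_cancel d'0); rewrite -[RHS]rmorphM -nd rmorphM.
by rewrite -[RHS]mulr1 -(fgK d'0); ring.
Qed.

Lemma frac_lift_zmod : zmod_morphism h.
Proof.
move=> x y; have dx := denom_ratioP (repr x); have dy := denom_ratioP (repr y).
have dxy := mulf_neq0 dx dy; apply: (frac_lift_cancel dxy).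
rewrite (@frac_lift_eq _ (\n_(repr x) * \d_(repr y) - \n_(repr y) * \d_(repr x)))//.
  rewrite mulrBl rmorphB !rmorphM /= -!(frac_lift_eq _ (frac_numden _))//.
  by ring.
by rewrite rmorphB !rmorphM /= -!frac_numden; ring.
Qed.

Lemma frac_lift_monoid : monoid_morphism h.
Proof.
split=> [|x y].
  have := @frac_lift_eq 1 1 1 (oner_neq0 _); rewrite !rmorph1 !mulr1; exact.
have dx := denom_ratioP (repr x); have dy := denom_ratioP (repr y).
have dxy := mulf_neq0 dx dy; apply: (frac_lift_cancel dxy).
rewrite (@frac_lift_eq _ (\n_(repr x) * \n_(repr y)))//.
  by rewrite !rmorphM /= -!(frac_lift_eq _ (frac_numden _))//; ring.
by rewrite !rmorphM /= -!frac_numden; ring.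
Qed.

End FractionLift.

Definition ratfun (k : fieldType) : Type := {fraction {poly k}}.
HB.instance Definition _ (k : fieldType) := GRing.Field.on (ratfun k).

Definition polyfrac (k : fieldType) : {rmorphism {poly k} -> ratfun k} :=
  @FracField.tofrac {poly k}.

Section Shift.
Variable k : fieldType.

Definition shift_poly (p : {poly k}) : {poly k} := p \Po ('X + 1).

Definition shift_ratfun (h : ratfun k) : ratfun k :=
  polyfrac k (shift_poly \n_(repr h)) / polyfrac k (shift_poly \d_(repr h)).

Lemma shift_poly_zmod : zmod_morphism shift_poly.
Proof. by move=> p q; rewrite /shift_poly rmorphB. Qed.

Lemma shift_poly_monoid : monoid_morphism shift_poly.
Proof. by split=> [|p q]; rewrite /shift_poly ?rmorph1 ?rmorphM. Qed.

HB.instance Definition _ :=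
  GRing.isZmodMorphism.Build {poly k} {poly k} shift_poly shift_poly_zmod.
HB.instance Definition _ :=
  GRing.isMonoidMorphism.Build {poly k} {poly k} shift_poly shift_poly_monoid.

Lemma shift_poly_eq0 p : (shift_poly p == 0) = (p == 0).
Proof.
apply/eqP/eqP => [|->]; last by rewrite rmorph0.
move=> /(congr1 (comp_poly ('X - 1))); rewrite /shift_poly -comp_polyA.
by rewrite comp_polyD comp_polyX -polyC1 comp_polyC subrK comp_polyXr linear0.
Qed.

Lemma shift_frac_fgK d : d != 0 ->
  (polyfrac k \o shift_poly) d * (polyfrac k (shift_poly d))^-1 = 1.
Proof.
by move=> d0; rewrite /= mulfV // /polyfrac tofrac_eq0 shift_poly_eq0.
Qed.

Lemma shift_ratfun_zmod : zmod_morphism shift_ratfun.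
Proof. exact: (frac_lift_zmod shift_frac_fgK (fun=> erefl)). Qed.

Lemma shift_ratfun_monoid : monoid_morphism shift_ratfun.
Proof. exact: (frac_lift_monoid shift_frac_fgK (fun=> erefl)). Qed.

HB.instance Definition _ :=
  GRing.isZmodMorphism.Build (ratfun k) (ratfun k) shift_ratfun
    shift_ratfun_zmod.
HB.instance Definition _ :=
  GRing.isMonoidMorphism.Build (ratfun k) (ratfun k) shift_ratfun
    shift_ratfun_monoid.
HB.instance Definition _ := hasSigma.Build (ratfun k) shift_ratfun.

Lemma sigma_polyfrac p : sigma (polyfrac k p) = polyfrac k (shift_poly p).
Proof.
have := frac_lift_eq shift_frac_fgK (h := shift_ratfun) (fun=> erefl)
  (x := polyfrac k p) (n := p) (oner_neq0 _).
by rewrite !rmorph1 !mulr1; apply.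
Qed.

End Shift.

Section SequenceRing.
Variable k : fieldType.
Implicit Types f g : nat -> k.

Definition eventually_zero : {pred nat -> k} :=
  fun f => `[< exists N, forall i, (N <= i)%N -> f i = 0 >].

Lemma eventually_zeroP f :
  reflect (exists N, forall i, (N <= i)%N -> f i = 0) (f \in eventually_zero).
Proof. exact: asboolP. Qed.

Lemma eventually_zero_ideal : idealr_closed eventually_zero.
Proof.
split.
- by apply/eventually_zeroP; exists 0%N.
- apply/negP => /eventually_zeroP[N /(_ N (leqnn N))] /eqP.
  by rewrite oner_eq0.
- move=> a f g /eventually_zeroP[N fN] /eventually_zeroP[M gM].
  apply/eventually_zeroP; exists (maxn N M) => i; rewrite geq_max => /andP[Ni Mi].
  have -> : (a * f + g) i = a i * f i + g i by [].
  by rewrite fN // gM // mulr0 addr0.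
Qed.

HB.instance Definition _ :=
  isIdealr.Build (nat -> k) eventually_zero eventually_zero_ideal.

Definition Seq : Type := {ideal_quot eventually_zero}.
HB.instance Definition _ := GRing.ComNzRing.on Seq.

Definition seq_class f : Seq := \pi_({ideal_quot eventually_zero}) f.

Lemma seq_class_surj (x : Seq) : exists f, x = seq_class f.
Proof.
by exists (repr (x : {ideal_quot eventually_zero})); rewrite /seq_class reprK.
Qed.

Lemma seq_class_eqP f g :
  seq_class f = seq_class g <-> exists N, forall i, (N <= i)%N -> f i = g i.
Proof.
split=> [/eqP|[N fg]].
  rewrite -Quotient.idealrBE => /eventually_zeroP[N fg]; exists N => i /fg.
  by move/eqP; rewrite subr_eq0 => /eqP.
apply/eqP; rewrite -Quotient.idealrBE; apply/eventually_zeroP; exists N => i /fg e.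
by apply/eqP; rewrite subr_eq0 e.
Qed.

Lemma seq_class_zmod : zmod_morphism seq_class.
Proof. by move=> f g; rewrite /seq_class -!pi_is_zmod_morphism. Qed.

Lemma seq_class_monoid : monoid_morphism seq_class.
Proof. exact: pi_is_monoid_morphism. Qed.

HB.instance Definition _ :=
  GRing.isZmodMorphism.Build (nat -> k) Seq seq_class seq_class_zmod.
HB.instance Definition _ :=
  GRing.isMonoidMorphism.Build (nat -> k) Seq seq_class seq_class_monoid.

Definition shift_seq (x : Seq) : Seq :=
  seq_class (fun i => repr (x : {ideal_quot eventually_zero}) i.+1).

Lemma shift_seq_class f : shift_seq (seq_class f) = seq_class (fun i => f i.+1).
Proof.
apply/seq_class_eqP; set x := seq_class f.
have /seq_class_eqP[N e] : seq_class (repr (x : {ideal_quot eventually_zero})) =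
  seq_class f by rewrite /seq_class reprK.
by exists N => i Ni; apply: e; rewrite (leq_trans Ni).
Qed.

Lemma shift_seq_zmod : zmod_morphism shift_seq.
Proof.
move=> x y; have [f ->] := seq_class_surj x; have [g ->] := seq_class_surj y.
by rewrite -rmorphB !shift_seq_class -rmorphB.
Qed.

Lemma shift_seq_monoid : monoid_morphism shift_seq.
Proof.
split=> [|x y]; first by rewrite -(rmorph1 seq_class) shift_seq_class.
have [f ->] := seq_class_surj x; have [g ->] := seq_class_surj y.
by rewrite -rmorphM !shift_seq_class -rmorphM.
Qed.

HB.instance Definition _ :=
  GRing.isZmodMorphism.Build Seq Seq shift_seq shift_seq_zmod.
HB.instance Definition _ :=
  GRing.isMonoidMorphism.Build Seq Seq shift_seq shift_seq_monoid.
HB.instance Definition _ := hasSigma.Build Seq shift_seq.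

Lemma sigma_seq_class f : sigma (seq_class f) = seq_class (fun i => f i.+1).
Proof. exact: shift_seq_class. Qed.

(* A zero of the denominator contributes an arbitrary value, which is harmless
   because in characteristic zero only finitely many naturals are zeros of it.
   This hypothesis is an argument only so that the morphism structure can be
   inferred. *)
Definition ratfun_seq (chk : [pchar k] =i pred0) (h : ratfun k) : Seq :=
  seq_class (fun i => (\n_(repr h)).[i%:R] / (\d_(repr h)).[i%:R]).

Section Char0.
Hypothesis chk : [pchar k] =i pred0.

Lemma natr_inj_char0 : injective (fun i => i%:R : k).
Proof.
have c0 := (pcharf0P k).1 chk.
suff H i j : (i <= j)%N -> i%:R = j%:R :> k -> i = j.
  by move=> i j; have [/H//|/ltnW/H e /esym/e] := leqP i j.
move=> ij /eqP; rewrite eq_sym -subr_eq0 -natrB // c0 subn_eq0 => ji.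
by apply/eqP; rewrite eqn_leq ij.
Qed.

Lemma poly_eventually_neq0 (p : {poly k}) : p != 0 ->
  exists N, forall i, (N <= i)%N -> p.[i%:R] != 0.
Proof.
have [m] := ubnP (size p); elim: m p => // m IHm p pm p0.
have [[j /rootP/factor_theorem[q pE]]|nor] := pselect (exists j, p.[j%:R] = 0).
  have q0 : q != 0 by apply: contra_neq p0 => q0; rewrite pE q0 mul0r.
  have [|//|N qN] := IHm q.
    by move: pm; rewrite pE size_Mmonic ?monicXsubC // size_XsubC addn2.
  exists (maxn N j.+1) => i; rewrite geq_max => /andP[Ni ji].
  rewrite pE hornerM mulf_neq0 ?qN // hornerXsubC subr_eq0.
  by apply: contraTneq ji => /natr_inj_char0 ->; rewrite ltnn.
by exists 0%N => i _; apply: contra_notN nor => /eqP e; exists i.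
Qed.

Definition poly_seq (p : {poly k}) : Seq := seq_class (fun i => p.[i%:R]).

Lemma poly_seq_zmod : zmod_morphism poly_seq.
Proof.
move=> p q; rewrite /poly_seq -rmorphB; congr seq_class.
by apply: funext => i; rewrite hornerD hornerN.
Qed.

Lemma poly_seq_monoid : monoid_morphism poly_seq.
Proof.
split=> [|p q]; rewrite /poly_seq -?(rmorph1 seq_class) -?rmorphM;
  by congr seq_class; apply: funext => i; rewrite ?hornerC ?hornerM.
Qed.

HB.instance Definition _ :=
  GRing.isZmodMorphism.Build {poly k} Seq poly_seq poly_seq_zmod.
HB.instance Definition _ :=
  GRing.isMonoidMorphism.Build {poly k} Seq poly_seq poly_seq_monoid.

Lemma poly_seq_fgK d : d != 0 ->
  poly_seq d * seq_class (fun i => d.[i%:R]^-1) = 1.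
Proof.
move=> /poly_eventually_neq0[N dN].
rewrite /poly_seq -(rmorph1 seq_class) -rmorphM; apply/seq_class_eqP.
by exists N => i /dN di; rewrite -[RHS](mulfV di).
Qed.

Lemma ratfun_seqE h : ratfun_seq chk h =
  poly_seq \n_(repr h) * seq_class (fun i => (\d_(repr h)).[i%:R]^-1).
Proof. by rewrite /poly_seq -rmorphM. Qed.

Lemma ratfun_seq_zmod : zmod_morphism (ratfun_seq chk).
Proof. exact: (frac_lift_zmod poly_seq_fgK ratfun_seqE). Qed.

Lemma ratfun_seq_monoid : monoid_morphism (ratfun_seq chk).
Proof. exact: (frac_lift_monoid poly_seq_fgK ratfun_seqE). Qed.

HB.instance Definition _ :=
  GRing.isZmodMorphism.Build (ratfun k) Seq (ratfun_seq chk) ratfun_seq_zmod.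
HB.instance Definition _ :=
  GRing.isMonoidMorphism.Build (ratfun k) Seq (ratfun_seq chk)
    ratfun_seq_monoid.

Lemma ratfun_seq_poly p : ratfun_seq chk (polyfrac k p) = poly_seq p.
Proof.
have := frac_lift_eq poly_seq_fgK ratfun_seqE
  (x := polyfrac k p) (n := p) (oner_neq0 _).
by rewrite !rmorph1 !mulr1; apply.
Qed.

Lemma ratfun_seqP : sigma_morphism (ratfun_seq chk).
Proof.
have sp p : ratfun_seq chk (sigma (polyfrac k p)) =
            sigma (ratfun_seq chk (polyfrac k p)).
  rewrite sigma_polyfrac !ratfun_seq_poly sigma_seq_class; congr seq_class.
  by apply: funext => i; rewrite horner_comp hornerD hornerX hornerC natr1.
move=> h; have d0 : polyfrac k \d_(repr h) != 0.
  by rewrite /polyfrac tofrac_eq0 denom_ratioP.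
have e := frac_numden h.
set d := polyfrac k _ in d0 *; set n := FracField.tofrac _ in e.
have u : ratfun_seq chk (sigma d) * ratfun_seq chk (sigma d)^-1 = 1.
  by rewrite -rmorphM mulfV ?rmorph1 // fmorph_eq0.
have sn : ratfun_seq chk (sigma (h * d)) = sigma (ratfun_seq chk (h * d)).
  by rewrite [h * d]e sp.
rewrite -[LHS]mulr1 -[RHS]mulr1 -u !mulrA; congr (_ * _).
by rewrite [in RHS]sp -!rmorphM.
Qed.

Definition Seq_alg : sigmaAlg (ratfun k) := SigmaAlg ratfun_seqP.

End Char0.
End SequenceRing.

(* Main.v *)
(* Let Y(x) = A(x-1) ... A(0) and R = k(z)[Y] in Seq_k.  The constants of Seq_k
   are k, so everything rests on a Skolem-Mahler-Lech statement for R: there is a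
   modulus M such that each element of R either vanishes on a given class mod M or
   is eventually nonzero there.  Since A and A^-1 have polynomial entries, their
   coefficients lie in a finitely generated subring S of k.  Such an S (suitably
   enlarged) carries a filtration, with S/a_1 finite and p in a_1, that behaves
   like the order at a closed point of a regular scheme over Z.  If p^2 | M and
   the product of M consecutive values of A is 1 mod a_1, then i |-> Y(j + M i) is
   given by a Mahler series whose m-th coefficient is in a_m, and Strassmann's
   argument applies to S-polynomials in Y.  Scalars from k outside of S are
   eliminated by linear algebra, so that M depends only on A.
   By this dichotomy the elements of R vanishing on a class form a prime ideal;
   the minimal period l of these ideals is the number of components of the total
   ring of fractions of R, and its idempotents are the indicators of classes
   mod l. *)

Require Import Defs.
From HB Require Import structures.
From mathcomp Require Import all_boot all_order all_algebra.
From mathcomp Require Import fraction boolp functions ring zify.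

Set Implicit Arguments.
Unset Strict Implicit.
Unset Printing Implicit Defensive.

Import GRing.Theory.
Local Open Scope ring_scope.

(** * Polynomials with coefficients in a subring or submodule of a field *)

Section Coefficients.
Variable k : fieldType.
Implicit Types (P S J : k -> Prop) (q f : {poly k}).

Definition coefs_in P q := forall i, P q`_i.

Definition subring_pred S :=
  [/\ S 1, forall x y, S x -> S y -> S (x - y)
    & forall x y, S x -> S y -> S (x * y)].

Definition submod_pred S J :=
  [/\ J 0, forall x y, J x -> J y -> J (x - y)
    & forall x y, S x -> J y -> J (x * y)].

Section Submodule.
Variables S J : k -> Prop.
Hypotheses (hS : subring_pred S) (hJ : submod_pred S J).

Lemma submod_pred0 : J 0. Proof. by case: hJ. Qed.

Lemma submod_predB x y : J x -> J y -> J (x - y).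
Proof. by case: hJ => _ + _; apply. Qed.

Lemma submod_predN x : J x -> J (- x).
Proof. by move=> Jx; rewrite -sub0r; apply: submod_predB => //; exact: submod_pred0. Qed.

Lemma submod_predD x y : J x -> J y -> J (x + y).
Proof. by move=> Jx Jy; rewrite -[y]opprK; apply/submod_predB/submod_predN. Qed.

Lemma submod_predM x y : S x -> J y -> J (x * y).
Proof. by case: hJ => _ _; apply. Qed.

Lemma submod_pred_sum (I : Type) (r : seq I) (Q : pred I) (F : I -> k) :
  (forall i, Q i -> J (F i)) -> J (\sum_(i <- r | Q i) F i).
Proof.
by move=> JF; elim/big_ind: _ => //; [exact: submod_pred0|exact: submod_predD].
Qed.

Lemma coefs_in_submodB f q :
  coefs_in J f -> coefs_in J q -> coefs_in J (f - q).
Proof. by move=> Jf Jq i; rewrite coefB; apply: submod_predB. Qed.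

Lemma coefs_in_submodM f q :
  coefs_in S f -> coefs_in J q -> coefs_in J (f * q).
Proof.
by move=> Sf Jq i; rewrite coefM; apply: submod_pred_sum => j _; apply: submod_predM.
Qed.

Lemma coefs_in_submodC x : J x -> coefs_in J x%:P.
Proof. by move=> Jx i; rewrite coefC; case: eqP => // _; exact: submod_pred0. Qed.

End Submodule.

Lemma subring_submod S : subring_pred S -> submod_pred S S.
Proof. by case=> S1 SB SM; split=> //; rewrite -(subrr 1); apply: SB. Qed.

Section Subring.
Variables S : k -> Prop.
Hypothesis hS : subring_pred S.
Let hSS := subring_submod hS.

Lemma subring_pred1 : S 1. Proof. by case: hS. Qed.

Lemma subring_predX x n : S x -> S (x ^+ n).
Proof.
move=> Sx; elim: n => [|n IHn]; first by rewrite expr0; exact: subring_pred1.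
by rewrite exprS; apply: (submod_predM hSS).
Qed.

Lemma subring_pred_nat n : S n%:R.
Proof.
elim: n => [|n IHn]; first exact: (submod_pred0 hSS).
by rewrite -natr1; apply: (submod_predD hSS) => //; exact: subring_pred1.
Qed.

Lemma coefs_in_X : coefs_in S 'X.
Proof. by move=> i; rewrite coefX; exact: subring_pred_nat. Qed.

Lemma coefs_in_Xn n : coefs_in S 'X^n.
Proof. by move=> i; rewrite coefXn; exact: subring_pred_nat. Qed.

Lemma coefs_in_horner q x : coefs_in S q -> S x -> S q.[x].
Proof.
move=> Sq Sx; rewrite horner_coef; apply: (submod_pred_sum hSS) => i _.
by apply: (submod_predM hSS) => //; apply: subring_predX.
Qed.

Lemma coefs_in_comp f q :
  coefs_in S f -> coefs_in S q -> coefs_in S (f \Po q).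
Proof.
move=> Sf Sq i; rewrite coef_comp_poly; apply: (submod_pred_sum hSS) => j _.
apply: (submod_predM hSS) => //.
elim: {j}(j : nat) i => [|j IHj] i.
  by rewrite expr0 coef1; exact: subring_pred_nat.
by rewrite exprS; apply: (coefs_in_submodM hSS).
Qed.

(** Multiplying by the leading coefficient of [q] replaces dividing by it, so quotient and remainder
    keep their coefficients in [J]. With [J = a m] this makes reductions respect a filtration. *)
Lemma pseudo_division J f q : submod_pred S J ->
    coefs_in J f -> coefs_in S q -> q != 0 ->
  exists N Q r, [/\ coefs_in J Q, coefs_in J r, (size r < size q)%N
    & (lead_coef q ^+ N)%:P * f = Q * q + r].
Proof.
move=> hJ Jf Sq q0; have [m] := ubnP (size f); elim: m f Jf => // m IHm f Jf fm.
have J0 : coefs_in J 0 by move=> i; rewrite coef0; exact: submod_pred0 hJ.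
have [fq|qf] := ltnP (size f) (size q).
  by exists 0%N, 0, f; rewrite expr0 mul1r mul0r add0r.
have [s sq] : exists s, size q = s.+1.
  by exists (size q).-1; rewrite prednK // size_poly_gt0.
have [a sf] : exists a, size f = (a + s).+1.
  by exists (size f - size q)%N; rewrite -addnS -sq subnK.
set l := lead_coef q; set t := (lead_coef f)%:P * 'X^a.
have Jt : coefs_in J t.
  rewrite /t mulrC; apply: (coefs_in_submodM hJ); first exact: coefs_in_Xn.
  by apply: (coefs_in_submodC hJ); exact: Jf.
have Jf' : coefs_in J (l%:P * f - q * t).
  apply: (coefs_in_submodB hJ); last exact: (coefs_in_submodM hJ).
  by apply: (coefs_in_submodM hJ) => //; apply: (coefs_in_submodC hSS); exact: Sq.
have [N [Q [r [JQ Jr rq E]]]] : exists N Q r, [/\ coefs_in J Q, coefs_in J r,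
    (size r < size q)%N & (l ^+ N)%:P * (l%:P * f - q * t) = Q * q + r].
  apply: IHm => //; move: fm; rewrite sf !ltnS; apply: leq_ltn_trans.
  apply/leq_sizeP => j; rewrite leq_eqVlt => /predU1P[<-|jf].
    rewrite coefB coefCM /t mulrA coefMXn ltnNge leq_addr addKn coefMC /=.
    by rewrite /l !lead_coefE sq sf /= subrr.
  rewrite coefB coefCM /t mulrA coefMXn coefMC.
  rewrite [f`_j]nth_default ?mulr0 ?sub0r ?sf //.
  case: ifP => _; rewrite ?oppr0 // nth_default ?mul0r ?oppr0 // sq.
  by rewrite ltn_subRL.
exists N.+1, (Q + (l ^+ N)%:P * t), r; split=> //.
  move=> i; rewrite coefD; apply: (submod_predD hJ) => //.
  apply: (coefs_in_submodM hJ) => //; apply: (coefs_in_submodC hSS).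
  exact/subring_predX/Sq.
rewrite exprSr polyCM -mulrA -[l%:P * f](subrK (q * t)) mulrDr E; ring.
Qed.

End Subring.
End Coefficients.

(** * Filtered subrings *)

Section Filtration.
Variable k : fieldType.

(* The axioms of the filtration by powers of the maximal ideal of a regular local
   ring in which [p] is part of a system of parameters; the subring itself is
   [a 0].  In contrast to embedding [a 0] into the p-adic integers, this requires
   neither completeness nor transcendental p-adic numbers. *)
Record pfiltration (p : nat) (a : nat -> k -> Prop) : Prop := PFiltration {
  pf_prime : prime p;
  pf_odd : (2 < p)%N;
  pf1 : a 0 1;
  pfB : forall m x y, a m x -> a m y -> a m (x - y);
  pfM : forall m l x y, a m x -> a l y -> a (m + l) (x * y);
  pfS : forall m x, a m.+1 x -> a m x;
  pfp : a 1 p%:R;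
  pf_divp : forall m x, a 0 x -> a m.+1 (p%:R * x) -> a m x;
  pf_sep : forall x, (forall m, a m x) -> x = 0;
  pf_fin : exists rs : seq k, forall x, a 0 x -> exists2 r, r \in rs & a 1 (x - r)
}.

Section Basics.
Variables (p : nat) (a : nat -> k -> Prop).
Hypothesis fa : pfiltration p a.

Lemma pf_le m l x : (l <= m)%N -> a m x -> a l x.
Proof. by move/subnK <-; elim: (m - l)%N => // j IHj /(pfS fa)/IHj. Qed.

Lemma pf_subring : subring_pred (a 0).
Proof.
by split; [exact: pf1 fa|exact: (pfB fa)|move=> x y ax ay; exact: (pfM fa ax ay)].
Qed.
Hint Resolve pf_subring : core.

Lemma pfpX m : a m (p%:R ^+ m).
Proof.
elim: m => [|m IHm]; first exact: pf1 fa.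
by rewrite exprS; exact: (pfM fa (pfp fa) IHm).
Qed.

Lemma pf_submod m : submod_pred (a 0) (a m).
Proof.
split; [|exact: (pfB fa)|move=> x y ax ay; exact: (pfM fa ax ay)].
by rewrite -(subrr (p%:R ^+ m)); apply: (pfB fa); exact: pfpX.
Qed.

(** In [x = h * (c * x) - (c * h - 1) * x] the factor [c * h - 1] has degree one, so [x] climbs the
    filtration one step at a time, without an inverse of [c] in [a 0]. *)
Lemma pf_unit_cancel c h m x : a 0 h -> a 1 (c * h - 1) -> a 0 x ->
  a m (c * x) -> a m x.
Proof.
move=> ah ch ax; elim: m => // m IHm acx; have /IHm am := pfS fa acx.
have -> : x = h * (c * x) - (c * h - 1) * x by ring.
by apply: (pfB fa); [exact: (pfM fa ah acx)|exact: (pfM fa ch am)].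
Qed.

Lemma pf_natr_coprime_cancel u m x : coprime u p -> a 0 x ->
  a m (u%:R * x) -> a m x.
Proof.
move=> up ax; have [u0|u0] := posnP u; last first.
  have [s t E _] := egcdnP p u0; apply: (@pf_unit_cancel _ s%:R) => //.
    exact: subring_pred_nat.
  move: E; rewrite (eqP up) => E.
  rewrite mulrC -natrM E natrD addrK natrM.
  by apply: (submod_predM (pf_submod 1)); [exact: subring_pred_nat|exact: pfp fa].
by move: up; rewrite u0 /coprime gcd0n => /eqP E; have := pf_prime fa; rewrite E.
Qed.

(** The part of [N] prime to [p] is a unit modulo [a 1], and each factor [p] costs one degree. This
    serves to divide by [T!] in Strassmann's argument. *)
Lemma pf_natr_cancel N m x : (0 < N)%N -> a 0 x ->
  a (m + logn p N) (N%:R * x) -> a m x.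
Proof.
move=> N0 ax; have [u up NE] := pfactor_coprime (pf_prime fa) N0.
have ae j : a 0 (p%:R ^+ j * x).
  apply: (submod_predM (pf_submod 0)) => //.
  by apply: subring_predX => //; exact: subring_pred_nat.
move: (logn p N) NE => e ->; rewrite natrM natrX -mulrA.
move=> /(@pf_natr_coprime_cancel u); rewrite coprime_sym => /(_ up (ae e)).
elim: e => [|e IHe]; first by rewrite addn0 expr0 mul1r.
by rewrite addnS exprS -mulrA => /(pf_divp fa (ae e))/IHe.
Qed.

Lemma pf_natr N : (0 < N)%N -> a (logn p N) N%:R.
Proof.
move=> N0; have [u up NE] := pfactor_coprime (pf_prime fa) N0.
rewrite {2}NE natrM natrX; apply: (submod_predM (pf_submod _)); last exact: pfpX.
exact: subring_pred_nat.
Qed.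

(** This is the filtration of [a 0] with [c] inverted. As [h] inverts [c] modulo [a 1],
    multiplication by [c] does not change the degree of an element of [a 0], which keeps the
    filtration separated. *)
Lemma pf_localization c h : c != 0 -> a 0 c -> a 0 h -> a 1 (c * h - 1) ->
  pfiltration p (fun m x => exists N, a m (c ^+ N * x)).
Proof.
move=> c0 ac ah ch.
have aX j x m : a m x -> a m (c ^+ j * x).
  by apply: (submod_predM (pf_submod m)); apply: subring_predX.
have cancel N m x : a 0 x -> a m (c ^+ N * x) -> a m x.
  move=> ax; elim: N => [|N IHN]; first by rewrite expr0 mul1r.
  by rewrite exprS -mulrA => /(pf_unit_cancel ah ch) H; apply/IHN/H/aX.
split.
- exact: pf_prime fa.
- exact: pf_odd fa.
- by exists 0%N; rewrite mul1r; exact: pf1 fa.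
- move=> m x y [N Nx] [N' Ny]; exists (N + N')%N.
  rewrite mulrBr; apply: (pfB fa); last by rewrite exprD -mulrA; apply: aX.
  by rewrite addnC exprD -mulrA; apply: aX.
- move=> m l x y [N Nx] [N' Ny]; exists (N + N')%N.
  by rewrite exprD mulrACA; apply: (pfM fa).
- by move=> m x [N /(pfS fa) Nx]; exists N.
- by exists 0%N; rewrite mul1r; exact: pfp fa.
- move=> m x [N Nx] [N' px]; exists (N + N')%N; apply: (pf_divp fa).
    by rewrite addnC exprD -mulrA; apply: aX.
  by rewrite mulrCA exprD -mulrA; apply: aX.
- move=> x H; have [N Nx] := H 0%N.
  suff /eqP : c ^+ N * x = 0 by rewrite mulf_eq0 expf_eq0 (negPf c0) andbF => /eqP.
  apply: (pf_sep fa) => m; have [N' Nx'] := H m.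
  by apply: (cancel N') => //; rewrite mulrCA; apply: aX.
have [rs rsP] := pf_fin fa; exists rs => x [N Nx].
(* In the new filtration [x] agrees modulo degree one with [h ^+ N * (c ^+ N * x)], an element of
   [a 0], so the old representatives suffice. *)
have [r rrs ar] : exists2 r, r \in rs & a 1 (h ^+ N * (c ^+ N * x) - r).
  by apply/rsP/(submod_predM (pf_submod 0)) => //; apply: subring_predX.
exists r => //; exists N.
have -> : c ^+ N * (x - r) = (1 - (c * h) ^+ N) * (c ^+ N * x)
    + c ^+ N * (h ^+ N * (c ^+ N * x) - r) by rewrite exprMn; ring.
apply: (submod_predD (pf_submod 1)); last exact: aX.
rewrite mulrC; apply: (submod_predM (pf_submod 1)) => //.
rewrite -opprB; apply: (submod_predN (pf_submod 1)).
rewrite subrX1 mulrC; apply: (submod_predM (pf_submod 1)) => //.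
apply: (submod_pred_sum (pf_submod 0)) => i _; apply: subring_predX => //.
exact: (submod_predM (pf_submod 0)).
Qed.

End Basics.

(* The element [g] is what will have to be inverted: denominators, and leading
   coefficients of algebraic relations. *)
Definition good_subring (S : k -> Prop) :=
  forall g, S g -> g != 0 ->
  exists p a, [/\ pfiltration p a, a 0 = S & exists2 h, S h & a 1 (g * h - 1)].

Definition int_subring (x : k) := exists n : int, x = n%:~R.

Definition adjoin_elt (S : k -> Prop) (c x : k) :=
  exists2 q : {poly k}, coefs_in S q & x = q.[c].

(** The filtration is the [p]-adic one. A prime above both 2 and [|n|] is odd and does not divide
    the prescribed nonzero [n]; Bezout gives the inverse modulo [p]. *)
Lemma good_int_subring : [pchar k] =i pred0 -> good_subring int_subring.
Proof.
move=> chk.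
have intr0 (n : int) : n%:~R = 0 :> k -> n = 0.
  move=> /eqP E; have c0 := (pcharf0P k).1 chk; move: E.
  case: n => n; first by rewrite -pmulrn c0 => /eqP ->.
  by rewrite NegzE mulrNz oppr_eq0 -pmulrn c0.
have intr_inj (m n : int) : m%:~R = n%:~R :> k -> m = n.
  by move/eqP; rewrite -subr_eq0 -intrB => /eqP/intr0/eqP; rewrite subr_eq0 => /eqP.
move=> _ [n ->] n0; have n0' : n != 0 by apply: contraNneq n0 => ->.
have [p pgt pp] := prime_above (maxn 2 `|n|).
have [p2 pn] : (2 < p /\ `|n| < p)%N by move: pgt; rewrite gtn_max => /andP[].
pose a m (x : k) := exists n : int, x = (p%:Z ^+ m * n)%:~R.
exists p, a; split.
- split=> //.
  + by exists 1; rewrite mulr1.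
  + by move=> m _ _ [x ->] [y ->]; exists (x - y); rewrite mulrBr intrB.
  + move=> m l _ _ [x ->] [y ->]; exists (x * y).
    by rewrite exprD mulrACA [in RHS]intrM.
  + by move=> m _ [x ->]; exists (p%:Z * x); rewrite mulrA -exprSr.
  + by exists 1; rewrite mulr1.
  + move=> m _ [x ->] [y]; rewrite expr0 mul1r exprS.
    rewrite [p%:R]pmulrn -intrM => /intr_inj; rewrite -mulrA => /mulfI E.
    by exists y; rewrite E // eqz_nat -lt0n prime_gt0.
  + move=> x H; have [y xE] := H 0%N; rewrite expr0 mul1r in xE; subst x.
    have [->|y0] := eqVneq y 0; first by [].
    (* Degree [|y|] already excludes a nonzero [y], because [|y| < p ^ |y|]. *)
    have [z /intr_inj E] := H `|y|%N; have := congr1 absz E.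
    have z0 : (0 < `|z|)%N.
      by rewrite absz_gt0; apply: contraNneq y0 => z0; rewrite E z0 mulr0.
    rewrite abszM abszX absz_nat => E'; have := ltn_expl `|y| (prime_gt1 pp).
    by rewrite {1}E' ltnNge leq_pmulr.
  + exists [seq i%:R | i <- iota 0 p] => _ [y ->]; rewrite expr0 mul1r.
    have p0 : p%:Z != 0 by rewrite eqz_nat -lt0n prime_gt0.
    have lep := modz_ge0 y p0.
    have ltp : (y %% p < p)%Z by apply: ltz_pmod; rewrite ltz_nat prime_gt0.
    exists `|(y %% p)%Z|%N%:R; last first.
      exists (y %/ p)%Z; rewrite expr1 {1}(divz_eq y p) pmulrn (gez0_abs lep).
      by rewrite -intrB addrK mulrC.
    apply: map_f; rewrite mem_iota add0n -ltz_nat (gez0_abs lep).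
    exact: ltp.
- apply: funext => x; apply: propext; split=> -[m ->].
    by exists m; rewrite expr0 mul1r.
  by exists m; rewrite expr0 mul1r.
have cnp : coprimez n p.
  rewrite /coprimez /gcdz absz_nat eqz_nat -/(coprime _ _) coprime_sym prime_coprime //.
  by apply: contraL pn => /dvdn_leq; rewrite absz_gt0 -leqNgt; apply.
have [u [v E]] := Bezoutz n p; exists u%:~R; first by exists u.
exists (- v); rewrite -intrM -(intrB _ _ 1) expr1; congr intmul.
by rewrite -(eqP cnp) -E; ring.
Qed.

End Filtration.

(** * Adjoining a transcendental or integral element to a good subring *)

Section Adjunction.
Variable k : fieldType.
Variables (S : k -> Prop) (c : k).
Hypothesis hS : subring_pred S.
Let hSS := subring_submod hS.

Lemma adjoin_elt_subring : subring_pred (adjoin_elt S c).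
Proof.
split.
- exists 1; last by rewrite hornerC.
  exact: (coefs_in_submodC hSS) (subring_pred1 hS).
- move=> _ _ [q Sq ->] [r Sr ->]; exists (q - r); last by rewrite !hornerE.
  exact: (coefs_in_submodB hSS).
- move=> _ _ [q Sq ->] [r Sr ->]; exists (q * r); last by rewrite !hornerE.
  exact: (coefs_in_submodM hSS).
Qed.

Lemma sub_adjoin1 x : S x -> adjoin_elt S c x.
Proof.
by move=> Sx; exists x%:P; rewrite ?hornerC //; apply: (coefs_in_submodC hSS).
Qed.

Lemma adjoin_elt_gen : adjoin_elt S c c.
Proof. by exists 'X; rewrite ?hornerX //; exact: coefs_in_X. Qed.

(* The filtration gives weight one to [c - N], where the integer [N] is chosen such
   that [q.[N] != 0] for the element [q.[c]] to be made a unit. *)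
Lemma good_adjoin_transcendental : [pchar k] =i pred0 -> good_subring S ->
    (forall q, coefs_in S q -> q.[c] = 0 -> q = 0) ->
  good_subring (adjoin_elt S c).
Proof.
move=> chk gS tr g [q Sq gE] g0.
have q0 : q != 0 by apply: contraNneq g0 => q0; rewrite gE q0 horner0.
have [N /(_ N (leqnn N)) q1] := poly_eventually_neq0 chk q0.
have SN : S N%:R by exact: subring_pred_nat.
have [p [a [fa a0S [h Sh ah]]]] := gS _ (coefs_in_horner hS Sq SN) q1.
have Sshift e (y : k) : S y -> coefs_in S e -> coefs_in S (e \Po ('X + y%:P)).
  move=> Sy Se; apply: (coefs_in_comp hS) => // i; rewrite coefD.
  apply: (submod_predD hSS); first exact: coefs_in_X.
  exact: (coefs_in_submodC hSS).
set c' := c - N%:R.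
have cE e : e.[c] = (e \Po ('X + N%:R%:P)).[c'] by rewrite horner_comp !hornerE subrK.
have c'E e : e.[c'] = (e \Po ('X + (- N%:R)%:P)).[c] by rewrite horner_comp !hornerE.
have SN' : S (- N%:R) by apply: (submod_predN hSS).
have tr' e : coefs_in S e -> e.[c'] = 0 -> e = 0.
  move=> Se; rewrite c'E => /tr E.
  have : (e \Po ('X + (- N%:R)%:P)) \Po ('X + N%:R%:P) = e.
    by rewrite -comp_polyA comp_polyD comp_polyX comp_polyC polyCN addrK comp_polyXr.
  by rewrite E ?comp_poly0 => [<-|]; last exact: Sshift.
have inS m x : a m x -> S x by move=> /(pf_le fa (leq0n m)); rewrite a0S.
have lift_eq e f : coefs_in S e -> coefs_in S f -> e.[c'] = f.[c'] -> e = f.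
  move=> Se Sf ef; apply/eqP; rewrite -subr_eq0; apply/eqP/tr'.
    exact: (coefs_in_submodB hSS).
  by rewrite !hornerE ef subrr.
(* The subtraction is truncated: coefficients of index at least [m] are only asked to lie in
   [a 0]. *)
pose b m x := exists2 e : {poly k}, (forall d, a (m - d)%N e`_d) & x = e.[c'].
have bC m x : a m x -> b m x.
  move=> ax; exists x%:P; rewrite ?hornerC // => -[|d]; rewrite coefC /= ?subn0 //.
  exact: (submod_pred0 (pf_submod fa _)).
exists p, b; split.
- split.
  + exact: pf_prime fa.
  + exact: pf_odd fa.
  + exact/bC/(pf1 fa).
  + move=> m _ _ [e ae ->] [f af ->]; exists (e - f); last by rewrite !hornerE.
    by move=> d; rewrite coefB; apply: (pfB fa).
  + move=> m l _ _ [e ae ->] [f af ->]; exists (e * f); last by rewrite !hornerE.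
    move=> d; rewrite coefM; apply: (submod_pred_sum (pf_submod fa _)) => i _.
    apply: (pf_le fa) (pfM fa (ae i) (af (d - i)%N)).
    have := ltn_ord i; lia.
  + move=> m _ [e ae ->]; exists e => // d; apply: (pf_le fa) (ae d).
    by rewrite leq_sub2r.
  + exact/bC/(pfp fa).
  + move=> m x [e ae ->] [f af pf]; exists e => // d.
    have fE : p%:R%:P * e = f.
      apply: lift_eq; last by rewrite -pf !hornerE.
        apply: (coefs_in_submodM hSS) => [|i]; last exact: inS (ae i).
        exact: (coefs_in_submodC hSS) (subring_pred_nat hS p).
      by move=> i; exact: inS (af i).
    have := af d; rewrite -fE coefCM; have [dm|md] := leqP d m.
      rewrite subSn // => /(pf_divp fa); apply; apply: (pf_le fa) (ae d) => //.
    by move=> _; have := ae d; rewrite sub0n (eqP (ltnW md : (m - d == 0)%N)).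
  + move=> x H; have [e ae xE] := H 0%N; rewrite xE.
    suff -> : e = 0 by rewrite horner0.
    apply/polyP => d; rewrite coef0; apply: (pf_sep fa) => m.
    (* Expansions in [c'] are unique, and degree [m + d] puts the coefficient of index [d] in
       [a m]. *)
    have [f af] := H (m + d)%N; rewrite xE => /lift_eq -> //.
    * by have := af d; rewrite addnK.
    * by move=> i; exact: inS (ae i).
    * by move=> i; exact: inS (af i).
  (* As [c'] has weight one, only the constant coefficient counts modulo [b 1]. *)
  + have [rs rsP] := pf_fin fa; exists rs => _ [e ae ->].
    have [r rrs ar] := rsP _ (ae 0%N); exists r => //.
    exists (e - r%:P); last by rewrite !hornerE.
    move=> [|d]; rewrite coefB coefC /= ?subr0 //; exact: ae.
- apply: funext => x; apply: propext; split=> [[e ae ->]|[e Se ->]].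
    by rewrite c'E; eexists; last reflexivity; apply: Sshift => // d; exact: inS (ae d).
  by rewrite cE; eexists; last reflexivity; move=> d; rewrite a0S; exact: Sshift.
exists h; first exact: sub_adjoin1.
exists ((q \Po ('X + N%:R%:P)) * h%:P - 1); last by rewrite !hornerE -cE gE.
move=> [|d]; rewrite coefB coefMC coef1 /=.
  rewrite -[_`_0]horner_coef0 horner_comp !hornerE.
  exact: ah.
rewrite subr0 a0S; apply: (submod_predM hSS); last by [].
exact: Sshift.
Qed.

Section Integral.
Variable F : {poly k}.
Hypotheses (SF : coefs_in S F) (F1 : F \is monic) (Fc : F.[c] = 0).
Hypothesis Fmin :
  forall q, coefs_in S q -> (size q < size F)%N -> q.[c] = 0 -> q = 0.

Lemma integral_reduction J q : submod_pred S J -> coefs_in J q ->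
  exists r, [/\ coefs_in J r, (size r < size F)%N & r.[c] = q.[c]].
Proof.
move=> hJ Jq.
have [N [Q [r [_ Jr rF E]]]] := pseudo_division hS hJ Jq SF (monic_neq0 F1).
exists r; split=> //; move: E; rewrite (eqP F1) expr1n mul1r => ->.
by rewrite !hornerE Fc mulr0 add0r.
Qed.

(** Pseudo-division of [F] by [q], evaluated at [c], gives [q.[c] * (- Q.[c]) = r.[c]] with [r]
    smaller than [q], and induction applies to [r]. Inverting an element of the extension is thereby
    reduced to inverting one of [S]. *)
Lemma integral_inverse q : coefs_in S q -> (size q < size F)%N -> q != 0 ->
  exists h r, [/\ adjoin_elt S c h, S r, r != 0 & q.[c] * h = r].
Proof.
have [m] := ubnP (size q); elim: m q => // m IHm q qm Sq qF q0.
have [q1|q1] := leqP (size q) 1.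
  exists 1, q`_0; split=> //.
  - exact: (subring_pred1 adjoin_elt_subring).
  - by apply: contraNneq q0 => E; rewrite (size1_polyC q1) E.
  - by rewrite mulr1 {1}(size1_polyC q1) hornerC.
have [N [Q [r [SQ Sr rq E]]]] := pseudo_division hS hSS SF Sq q0.
have l0 : lead_coef q != 0 by rewrite lead_coef_eq0.
have Ec : Q.[c] * q.[c] + r.[c] = 0.
  by rewrite -hornerM -hornerD -E hornerM Fc mulr0.
have r0 : r != 0.
  (* If [r] were zero, [Q] would vanish at [c] and, [q] being non-constant, be smaller than [F].
     Minimality would force [Q = 0], which is absurd. *)
  apply/eqP => r0; move: Ec E; rewrite r0 horner0 !addr0 => Ec E.
  have qc : q.[c] != 0 by apply: contra_neq q0; exact: Fmin.
  have Q0 : Q != 0.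
    apply/eqP => Q0; move/eqP: E; rewrite Q0 mul0r mulf_eq0 (negPf (monic_neq0 F1)).
    by rewrite polyC_eq0 expf_eq0 (negPf l0) andbF.
  have sQ : (size Q < size F)%N.
    have := congr1 (fun e : {poly k} => size e) E.
    rewrite /= [RHS]size_mul // mul_polyC size_scale ?expf_neq0 //.
    move: q1; have := size_poly_gt0 F; rewrite monic_neq0 // => _ + ->.
    case: (size q) => [|[|s]] // _; rewrite !addnS /= ltnS; exact: leq_addr.
  move/eqP: Ec; rewrite mulf_eq0 (negPf qc) orbF => /eqP/(Fmin SQ sQ) /eqP.
  exact/negP.
have [||//|h [t [Sh St t0 ht]]] := IHm r _ Sr.
- exact: leq_trans rq _.
- exact: ltn_trans qF.
exists (- (Q.[c] * h)), t; split=> //.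
  apply: (submod_predN (subring_submod adjoin_elt_subring)).
  by case: adjoin_elt_subring => _ _; apply=> //; exists Q.
rewrite -ht; move/eqP: Ec; rewrite addrC addr_eq0 => /eqP ->; ring.
Qed.

(** The powers of [c] below the degree of [F] form a basis over [S], so the filtration extends
    coefficientwise: separation and division by [p] are read off the coefficients, and residues are
    finitely many coefficient vectors. Goodness of [S] is applied to the nonzero multiple [r] of [g]
    in [S]. *)
Lemma good_adjoin_integral : good_subring S -> good_subring (adjoin_elt S c).
Proof.
move=> gS g [q0 Sq0 gE0] g0.
have [q [Sq qF qE]] := integral_reduction hSS Sq0.
have {q0 Sq0 qE gE0}gE : g = q.[c] by rewrite qE.
have q0 : q != 0 by apply: contraNneq g0 => q0; rewrite gE q0 horner0.
have [h1 [r [Sh1 Sr r0 hr]]] := integral_inverse Sq qF q0.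
have [p [a [fa a0S [h Sh ah]]]] := gS _ Sr r0.
have inS m x : a m x -> S x by move=> /(pf_le fa (leq0n m)); rewrite a0S.
have hJ m : submod_pred S (a m) by rewrite -a0S; exact: (pf_submod fa m).
have lift_eq e f : coefs_in S e -> coefs_in S f -> (size e < size F)%N ->
    (size f < size F)%N -> e.[c] = f.[c] -> e = f.
  move=> Se Sf eF fF ef; apply/eqP; rewrite -subr_eq0; apply/eqP/Fmin.
  - exact: (coefs_in_submodB hSS).
  - by apply: leq_ltn_trans (size_polyD _ _) _; rewrite size_polyN gtn_max eF.
  - by rewrite !hornerE ef subrr.
pose b m x := exists2 e : {poly k}, coefs_in (a m) e & x = e.[c].
have bS m x : b m x -> exists e, [/\ coefs_in (a m) e, (size e < size F)%N & x = e.[c]].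
  move=> [e ae ->]; have [f [af fF fe]] := integral_reduction (hJ m) ae.
  by exists f.
have bC m x : a m x -> b m x.
  by move=> ax; exists x%:P; rewrite ?hornerC //; apply: (coefs_in_submodC (hJ m)).
have b0S : b 0%N = adjoin_elt S c by rewrite /b a0S.
exists p, b; split=> //.
- split.
  + exact: pf_prime fa.
  + exact: pf_odd fa.
  + exact/bC/(pf1 fa).
  + move=> m _ _ [e ae ->] [f af ->]; exists (e - f); last by rewrite !hornerE.
    exact: (coefs_in_submodB (hJ m)).
  + move=> m l _ _ [e ae ->] [f af ->]; exists (e * f); last by rewrite !hornerE.
    move=> d; rewrite coefM; apply: (submod_pred_sum (hJ _)) => i _.
    exact: (pfM fa).
  + by move=> m _ [e ae ->]; exists e => // d; apply: (pfS fa).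
  + exact/bC/(pfp fa).
  + move=> m x /bS[e [ae eF ->]] /bS[f [af fF pf]]; exists e => // d.
    have fE : p%:R%:P * e = f.
      apply: lift_eq => //; last by rewrite -pf !hornerE.
      * apply: (coefs_in_submodM hSS) => [|i]; last exact: inS (ae i).
        exact: (coefs_in_submodC hSS) (subring_pred_nat hS p).
      * by move=> i; exact: inS (af i).
      * by rewrite mul_polyC (leq_ltn_trans (size_scale_leq _ _)).
    by have := af d; rewrite -fE coefCM => /(pf_divp fa); apply.
  + move=> x H; have /bS[e [ae eF xE]] := H 0%N; rewrite xE.
    suff -> : e = 0 by rewrite horner0.
    apply/polyP => d; rewrite coef0; apply: (pf_sep fa) => m.
    have /bS[f [af fF]] := H m; rewrite xE => /lift_eq -> //.
    * by move=> i; exact: inS (ae i).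
    * by move=> i; exact: inS (af i).
  + have [rs rsP] := pf_fin fa; pose n := (size F).-1.
    exists [seq \sum_(i < n) nth 0 rs (f i) * c ^+ i | f : {ffun 'I_n -> 'I_(size rs)}].
    move=> x /bS[e [ae eF ->]].
    have /fin_all_exists[f fP] (i : 'I_n) : exists j : 'I_(size rs), a 1 (e`_i - nth 0 rs j).
      have [t /(nthP 0)[j jrs <-] at1] := rsP _ (ae i).
      by exists (Ordinal jrs).
    exists (\sum_(i < n) nth 0 rs (f i) * c ^+ i).
      apply/mapP; exists (finfun f); first by rewrite mem_enum.
      by apply: eq_bigr => i _; rewrite ffunE.
    exists (\sum_(i < n) (e`_i - nth 0 rs (f i))%:P * 'X^i).
      move=> d; rewrite coef_sum; apply: (submod_pred_sum (hJ 1%N)) => i _.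
      rewrite mulrC; apply: (coefs_in_submodM (hJ 1%N)); first exact: coefs_in_Xn.
      by apply: (coefs_in_submodC (hJ 1%N)).
    have en : (size e <= n)%N by rewrite -ltnS prednK // (leq_ltn_trans _ eF).
    rewrite (horner_coef_wide _ en) -sumrB horner_sum; apply: eq_bigr => i _.
    by rewrite !hornerE mulrBl.
exists (h1 * h).
  by case: adjoin_elt_subring => _ _; apply=> //; exact: sub_adjoin1.
by rewrite gE mulrA hr; exact: bC.
Qed.

End Integral.

End Adjunction.

(** * Existence of a filtered subring containing given elements *)

Section Existence.
Variable k : fieldType.
Hypothesis chk : [pchar k] =i pred0.

(** A transcendental [x] is adjoined directly. Otherwise, with [l] the leading coefficient of an
    annihilating polynomial of least degree, [l * x] is integral and is adjoined instead; hence the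
    denominator [t] in the conclusion. *)
Lemma good_adjoin_fraction (S : k -> Prop) x : subring_pred S -> good_subring S ->
  exists S', [/\ subring_pred S', good_subring S', (forall y, S y -> S' y)
    & exists t, [/\ S' t, t != 0 & S' (t * x)]].
Proof.
move=> hS gS.
have [tr|/existsNP[q0 /not_implyP[Sq0 /not_implyP[q0x /eqP q00]]]] :=
  pselect (forall q, coefs_in S q -> q.[x] = 0 -> q = 0).
  exists (adjoin_elt S x); split.
  - exact: adjoin_elt_subring.
  - exact: good_adjoin_transcendental.
  - by move=> y; exact: sub_adjoin1.
  - exists 1; split; rewrite ?oner_neq0 ?mul1r //; last exact: adjoin_elt_gen.
    exact: (subring_pred1 (adjoin_elt_subring _ hS)).
have [f [Sf f0 fx fmin]] : exists f, [/\ coefs_in S f, f != 0, f.[x] = 0 &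
    forall q, coefs_in S q -> (size q < size f)%N -> q.[x] = 0 -> q = 0].
  have [m] := ubnP (size q0); elim: m q0 Sq0 q0x q00 => // m IHm q0 Sq0 q0x q00 qm.
  have [mi|/existsNP[q /not_implyP[Sq /not_implyP[qq /not_implyP[qx /eqP qn]]]]] :=
    pselect (forall q, coefs_in S q -> (size q < size q0)%N -> q.[x] = 0 -> q = 0).
    by exists q0.
  by apply: (IHm q) => //; apply: leq_trans qq _.
set l := lead_coef f; have l0 : l != 0 by rewrite lead_coef_eq0.
have Sl : S l by exact: Sf.
have [m mE] : exists m, size f = m.+1.
  by exists (size f).-1; rewrite prednK // size_poly_gt0.
have lE : l = f`_m by rewrite /l lead_coefE mE.
have hSS := subring_submod hS.
(* These are the coefficients of [l ^ (m - 1) * f(X / l)], which is monic with root [l * x]. Index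
   [m] is separate because [m.-1 - i] truncates there. *)
pose G i := if i == m then 1 else l ^+ (m.-1 - i) * f`_i.
have Gm : G m != 0 by rewrite /G eqxx oner_neq0.
pose F := \poly_(i < m.+1) G i.
have sF : size F = m.+1 by apply: size_poly_eq.
exists (adjoin_elt S (l * x)); split.
- exact: adjoin_elt_subring.
- apply: (good_adjoin_integral hS (F := F)) => //.
  + move=> i; rewrite coef_poly; case: ifP => _; last exact: (submod_pred0 hSS).
    rewrite /G; case: ifP => _; first exact: subring_pred1.
    by apply: (submod_predM hSS) => //; exact: subring_predX.
  + by rewrite monicE lead_coefE sF /= coef_poly ltnSn /G eqxx.
  + have m0 : (0 < m)%N.
      rewrite lt0n; apply/eqP => m0; move/eqP: fx.
      by rewrite (size1_polyC (_ : size f <= 1)%N) ?mE ?m0 // hornerC -m0 -lE (negPf l0).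
    rewrite horner_poly; have := congr1 ( *%R (l ^+ m.-1)) fx.
    rewrite mulr0 horner_coef mE mulr_sumr => fx'.
    rewrite -[RHS]fx'; apply: eq_bigr => i _.
    rewrite /G exprMn; case: eqP => [->|im].
      by rewrite -lE mul1r !mulrA -exprSr prednK.
    have im' : (i <= m.-1)%N by have := ltn_ord i; lia.
    by rewrite mulrACA -exprD subnK.
  (* Minimality transfers from [f] because [q(l X)] has the root [x] and is no larger than [q]. *)
  + move=> q Sq; rewrite sF -mE => qF qlx.
    have : \poly_(i < size q) (q`_i * l ^+ i) = 0.
      apply: fmin.
      * move=> i; rewrite coef_poly; case: ifP => _; last exact: (submod_pred0 hSS).
        by apply: (submod_predM hSS) => //; exact: subring_predX.
      * exact: leq_ltn_trans (size_poly _ _) qF.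
      * by rewrite horner_poly -[RHS]qlx horner_coef; apply: eq_bigr => i _; rewrite exprMn mulrA.
    move=> E; apply/polyP => i; rewrite coef0.
    have [qi|iq] := leqP (size q) i; first by rewrite nth_default.
    have := congr1 (fun e : {poly k} => e`_i) E; rewrite /= coef_poly iq coef0.
    by move/eqP; rewrite mulf_eq0 expf_eq0 (negPf l0) andbF orbF => /eqP.
- by move=> y; exact: sub_adjoin1.
- exists l; split => //; last exact: adjoin_elt_gen.
  exact: sub_adjoin1.
Qed.

Lemma exists_good_fractions (X : seq k) :
  exists S, [/\ subring_pred S, good_subring S &
    forall x, x \in X -> exists t, [/\ S t, t != 0 & S (t * x)]].
Proof.
elim: X => [|x X [S [hS gS SX]]].
  exists (@int_subring k); split=> //; last exact: good_int_subring.
  split; first by exists 1.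
    by move=> _ _ [m ->] [n ->]; exists (m - n); rewrite intrB.
  by move=> _ _ [m ->] [n ->]; exists (m * n); rewrite intrM.
have [S' [hS' gS' SS' S'x]] := good_adjoin_fraction x hS gS.
exists S'; split=> // y; rewrite inE => /predU1P[->//|/SX[t [St t0 ty]]].
by exists t; split=> //; exact: SS'.
Qed.

(** A common denominator [c] of [X] is found first. The prime is then chosen so that [c] is a unit
    modulo [a 1], and inverting [c] puts [X] in degree zero. *)
Lemma exists_pfiltration (X : seq k) :
  exists p a, pfiltration p a /\ forall x, x \in X -> a 0%N x.
Proof.
have [S [hS gS SX]] := exists_good_fractions X; have hSS := subring_submod hS.
have [c [Sc c0 cX]] : exists c, [/\ S c, c != 0 & forall x, x \in X -> S (c * x)].
  elim: X SX => [|x X IHX] SX.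
    by exists 1; split; [exact: subring_pred1|exact: oner_neq0|].
  have [|c [Sc c0 cX]] := IHX.
    by move=> y yX; apply: SX; rewrite inE yX orbT.
  have [t [St t0 tx]] := SX x (mem_head _ _).
  exists (c * t); split; [exact: (submod_predM hSS)|exact: mulf_neq0|].
  move=> y; rewrite inE => /predU1P[->|/cX cy].
    by rewrite -mulrA; exact: (submod_predM hSS).
  by rewrite mulrAC mulrC; exact: (submod_predM hSS).
have [p [a [fa aS [h Sh ah]]]] := gS c Sc c0; rewrite -aS in Sc Sh cX.
exists p, (fun m x => exists N, a m (c ^+ N * x)); split.
  exact: (pf_localization fa c0 Sc Sh ah).
by move=> x /cX; exists 1%N.
Qed.

End Existence.

(** * Strassmann's theorem for Mahler series *)

Definition fdiff (V : zmodType) (f : nat -> V) i := f i.+1 - f i.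

(** Legendre's formula sums the quotients [n %/ p ^ j]. As [p >= 3], each [q = n %/ p ^ m] satisfies
    [3 * (q %/ p) <= q], so twice a partial sum plus its last quotient stays below or equal to
    [n]. *)
Lemma logn_fact_half p n : prime p -> (2 < p)%N -> ((logn p n`!).*2 <= n)%N.
Proof.
move=> pp p2; rewrite logn_fact //.
suff H m : ((\sum_(1 <= j < m.+1) n %/ p ^ j).*2 + n %/ p ^ m <= n)%N.
  by apply: leq_trans (H n); exact: leq_addr.
elim: m => [|m IHm]; first by rewrite big_geq // expn0 divn1.
rewrite big_nat_recr //= doubleD; apply: leq_trans IHm.
rewrite -addnA leq_add2l -addnn -addnA expnSr divnMA.
set q := (n %/ p ^ m)%N; apply: leq_trans (leq_trunc_div q p).
apply: (@leq_trans (q %/ p * 3)); last by rewrite leq_mul2l p2 orbT.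
by rewrite !mulnS muln0 addn0.
Qed.

(** Binomials with [j > n] vanish, so one [T] serves all [n < T] and a single polynomial
    interpolates [f] on an interval. *)
Lemma newton_forward (V : zmodType) (f : nat -> V) n x T : (n < T)%N ->
  f (x + n)%N = \sum_(j < T) iter j (@fdiff V) f x *+ 'C(n, j).
Proof.
have fdS j (y : nat) : iter j (@fdiff V) f y.+1 =
    iter j (@fdiff V) f y + iter j.+1 (@fdiff V) f y.
  by rewrite /= /fdiff addrC subrK.
elim: n x T => [|n IHn] x [//|T].
  rewrite big_ord_recl /= big1 ?addr0 ?addn0 //= => i _.
rewrite ltnS => nT; rewrite -addSnnS (IHn _ _ nT).
have E : \sum_(j < T) iter j (@fdiff V) f x *+ 'C(n, j) =
    f x + \sum_(j < T) iter j.+1 (@fdiff V) f x *+ 'C(n, j.+1).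
  rewrite -(IHn x T nT) (IHn x T.+1 (ltnW nT)) big_ord_recl bin0 mulr1n.
  by congr (_ + _).
under eq_bigr => j _ do rewrite fdS mulrnDl.
rewrite big_split /= E [RHS]big_ord_recl bin0 mulr1n -addrA.
congr (_ + _); rewrite -big_split; apply: eq_bigr => j _.
by rewrite lift0 binS mulrnDr.
Qed.

Section Nice.
Variables (k : fieldType) (p : nat) (a : nat -> k -> Prop).
Hypothesis fa : pfiltration p a.
Implicit Types f g : nat -> k.

(** For [t <= m] the [t]-th difference takes values in [a (j + t * w)]. Asking this at every point,
    while Mahler coefficients only concern 0, lets the product rule apply; the finite depth [m]
    permits induction. *)
Fixpoint nice (w m j : nat) f : Prop :=
  (forall i, a j (f i)) /\ if m is m'.+1 then nice w m' (j + w) (fdiff f) else True.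

Lemma nice_val w m j f : nice w m j f -> forall i, a j (f i).
Proof. by case: m => [|m] []. Qed.

Lemma nice_weaken w w' m j l f : (w' <= w)%N -> (l <= j)%N ->
  nice w m j f -> nice w' m l f.
Proof.
move=> ww; elim: m j l f => [|m IHm] j l f lj /= [af nf].
  by split=> // i; apply: (pf_le fa) (af i).
by split=> [i|]; [exact: (pf_le fa) (af i)|apply: IHm nf; exact: leq_add].
Qed.

Lemma nice_depth w m j f : nice w m.+1 j f -> nice w m j f.
Proof.
elim: m j f => [|m IHm] j f /= [af nf]; first by split.
by split=> //; exact: IHm.
Qed.

Lemma nice_shift w m j f : nice w m j f -> nice w m j (fun i => f i.+1).
Proof.
elim: m j f => [|m IHm] j f /= [af nf]; first by split.
by split=> //; exact: IHm nf.
Qed.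

Lemma nice_sub w m j f g : nice w m j f -> nice w m j g ->
  nice w m j (fun i => f i - g i).
Proof.
elim: m j f g => [|m IHm] j f g /= [af nf] [ag ng].
  by split=> // i; exact: (pfB fa).
split=> [i|]; first exact: (pfB fa).
rewrite [fdiff _](_ : _ = fun i => fdiff f i - fdiff g i); first exact: IHm.
by apply: funext => i; rewrite /fdiff; ring.
Qed.

Lemma nice0 w m j : nice w m j (fun=> 0).
Proof.
have a0 j' : a j' 0 by exact: (submod_pred0 (pf_submod fa j')).
elim: m j => [|m IHm] j /=; split=> //.
rewrite [fdiff _](_ : _ = fun=> 0) //.
by apply: funext => i; rewrite /fdiff subrr.
Qed.

Lemma nice_add w m j f g : nice w m j f -> nice w m j g ->
  nice w m j (fun i => f i + g i).
Proof.
move=> nf ng; rewrite [fun i => _](_ : _ = fun i => f i - (0 - g i)).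
  by apply: nice_sub => //; apply: nice_sub => //; exact: nice0.
by apply: funext => i; rewrite sub0r opprK.
Qed.

Lemma nice_cst w m j x : a j x -> nice w m j (fun=> x).
Proof.
move=> ax; case: m => [|m]; split=> //.
rewrite [fdiff _](_ : _ = fun=> 0); first exact: nice0.
by apply: funext => i; rewrite /fdiff subrr.
Qed.

(** By the discrete Leibniz rule, each term of the difference of a product gains the weight [w]
    through one of its factors. *)
Lemma nice_mul w m j l f g : nice w m j f -> nice w m l g ->
  nice w m (j + l) (fun i => f i * g i).
Proof.
elim: m j l f g => [|m IHm] j l f g nf ng.
  by split=> // i; apply: (pfM fa); [exact: nice_val nf i|exact: nice_val ng i].
split=> [i|]; first by apply: (pfM fa); [exact: nice_val nf i|exact: nice_val ng i].
rewrite [fdiff _](_ : _ = fun i => fdiff f i * g i.+1 + f i * fdiff g i).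
  apply: nice_add.
    rewrite addnAC; apply: IHm; first by case: nf.
    exact/nice_shift/nice_depth.
  by rewrite -addnA; apply: IHm; [exact: nice_depth|case: ng].
by apply: funext => i; rewrite /fdiff; ring.
Qed.

Lemma nice_sum w m j (I : Type) (r : seq I) (F : I -> nat -> k) :
  (forall i, nice w m j (F i)) -> nice w m j (fun x => \sum_(i <- r) F i x).
Proof.
move=> nF; elim: r => [|i r IHr].
  by rewrite [fun x => _](_ : _ = fun=> 0) ?nice0 //;
     [exact: nice0|apply: funext => x; rewrite big_nil].
rewrite [fun x => _](_ : _ = fun x => F i x + \sum_(i <- r) F i x).
  exact: nice_add.
by apply: funext => x; rewrite big_cons.
Qed.

Lemma nice_iter_fdiff f : (forall m, nice 1 m 0 f) ->
  forall m, a m (iter m (@fdiff k) f 0%N).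
Proof.
move=> nf m.
suff H j l g : nice 1 l j g -> a (j + l)%N (iter l (@fdiff k) g 0%N).
  by have := H 0%N m f (nf m).
elim: l j g => [|l IHl] j g ng; first by rewrite addn0; exact: nice_val ng 0%N.
by rewrite addnS -addSn -addn1 iterSr; apply: IHl; case: ng.
Qed.

(** The recursion [q_e = ((X - t) q)_(e+1) + t q_(e+1)] is solved downwards from the size of [q]. *)
Lemma root_division_coefs J (r : nat) (q : {poly k}) t : submod_pred (a 0) J ->
    a 0 t -> (forall e, (r < e)%N -> J (('X - t%:P) * q)`_e) ->
  forall e, (r <= e)%N -> J q`_e.
Proof.
move=> hJ at0 H e re; have [m] := ubnP (size q - e).
elim: m e re => // m IHm e re qe.
have [qs|eq] := leqP (size q) e.
  by rewrite nth_default //; exact: (submod_pred0 hJ).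
have -> : q`_e = (('X - t%:P) * q)`_e.+1 + t * q`_e.+1.
  by rewrite mulrBl coefB coefXM coefCM /= subrK.
apply: (submod_predD hJ); first exact: H.
apply: (submod_predM hJ) => //; apply: IHm; first exact: leqW.
by move: qe eq; lia.
Qed.

(** Each root divided out lowers by one the index from which the coefficients lie in [J], until it
    reaches zero. *)
Lemma roots_division_coefs J (ts : seq k) (q : {poly k}) : submod_pred (a 0) J ->
    uniq ts -> all (root q) ts -> (forall t, t \in ts -> a 0 t) ->
    (forall e, (size ts <= e)%N -> J q`_e) ->
  exists2 Q, coefs_in J Q & q = \prod_(t <- ts) ('X - t%:P) * Q.
Proof.
move=> hJ; elim: ts q => [|t ts IHts] q.
  by move=> _ _ _ Jq; exists q; [move=> e; exact: Jq|rewrite big_nil mul1r].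
move=> /= /andP[tts uts] /andP[/factor_theorem[q1 qE] rts] at0 Jq.
have [|u uts'|e te|Q JQ q1E] := IHts q1 uts.
- apply/allP => u uts'; have /allP/(_ u uts') := rts.
  rewrite qE rootM root_XsubC => /orP[//|/eqP ut].
  by rewrite -ut uts' in tts.
- by apply: at0; rewrite inE uts' orbT.
- apply: (@root_division_coefs J (size ts) q1 t) => //.
    by apply: at0; exact: mem_head.
  by move=> d; rewrite mulrC -qE; exact: Jq.
by exists Q => //; rewrite big_cons qE q1E; ring.
Qed.

(* On [0, T] the function is the polynomial [\sum_j (d_j / j!) i^_j] with [d_j] in
   [a j], whose coefficients of degree at least [e] have filtration degree at least
   [e/2] because [p] is odd.  Dividing out [2 r] zeros leaves a polynomial all of
   whose coefficients have filtration degree at least [r]; [T!] clears the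
   denominators. *)
Lemma strassmann f : [pchar k] =i pred0 -> (forall m, nice 1 m 0 f) ->
  (forall N, exists2 i, (N <= i)%N & f i = 0) -> forall i, f i = 0.
Proof.
move=> chk nf inf x; apply: (pf_sep fa) => r.
have aS := pf_subring fa.
have [ts [uts sts tsf]] : exists ts : seq nat,
    [/\ uniq ts, size ts = r.*2 & forall t, t \in ts -> f t = 0].
  elim: (r.*2) => [|n [ts [uts sts tsf]]]; first by exists [::].
  have [t tN ft] := inf (\max_(t <- ts) t).+1.
  exists (t :: ts); rewrite /= uts sts; split=> //; last first.
    by move=> u; rewrite inE => /predU1P[->|/tsf].
  rewrite andbT; apply/negP => tts; move: tN; apply/negP; rewrite -leqNgt.
  by rewrite (@leq_bigmax_seq _ _ xpredT id _ tts).
set T := maxn x (\max_(t <- ts) t).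
have tT t : t \in ts -> (t <= T)%N.
  by move=> tts; rewrite leq_max (@leq_bigmax_seq _ _ xpredT id _ tts) ?orbT.
pose d j := iter j (@fdiff k) f 0%N.
have ad j : a j (d j) by exact: nice_iter_fdiff.
pose ff j : {poly k} := \prod_(l < j) ('X - l%:R%:P).
(* [T ^_ (T - j)] is [T! / j!], so [R] is [T!] times the Newton interpolation of [f] on [[0, T]]. *)
pose R : {poly k} := \sum_(j < T.+1) ((T ^_ (T - j))%:R * d j)%:P * ff j.
have ffE j i : (ff j).[i%:R] = (i ^_ j)%:R.
  rewrite horner_prod; elim: j => [|j IHj]; first by rewrite big_ord0.
  rewrite big_ord_recr /= IHj hornerXsubC ffactnSr natrM.
  have [ji|ij] := leqP j i; first by rewrite natrB.
  by rewrite ffact_small // !mul0r.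
have RE i : (i <= T)%N -> R.[i%:R] = (T`!)%:R * f i.
  move=> iT; rewrite (newton_forward f 0 (iT : i < T.+1)%N) mulr_sumr horner_sum.
  apply: eq_bigr => j _; rewrite hornerM hornerC ffE -/(d j) -(bin_ffact i j).
  rewrite -[T`!](ffact_fact (leq_subr j T)) subKn; last by rewrite -ltnS.
  rewrite !natrM -[d j *+ _]mulr_natr -!mulrA; congr (_ * _).
  by rewrite mulrA [RHS]mulrC [LHS]mulrC -mulrA.
have aff j e : a 0%N (ff j)`_e.
  elim: j e => [|j IHj] e.
    by rewrite /ff big_ord0 coef1; exact: subring_pred_nat.
  rewrite /ff big_ord_recr /= mulrC.
  apply: (coefs_in_submodM (pf_submod fa 0)) IHj e => i.
  rewrite coefB; apply: (pfB fa); first exact: coefs_in_X.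
  exact: (coefs_in_submodC (pf_submod fa 0)) (subring_pred_nat aS j) i.
have sff j : size (ff j) = j.+1.
  by rewrite /ff size_prod_XsubC /= -[LHS]/(size (index_enum _)).+1 /index_enum -enumT size_enum_ord.
pose v := logn p T`!.
have [Q aQ RQ] : exists2 Q, coefs_in (a (r + v)%N) Q &
    R = \prod_(t <- [seq t%:R | t <- ts]) ('X - t%:P) * Q.
  apply: roots_division_coefs; first exact: (pf_submod fa _).
  - by rewrite map_inj_uniq //; exact: natr_inj_char0.
  - apply/allP => _ /mapP[t tts ->]; rewrite /root RE ?tT // tsf // mulr0 //.
  - by move=> _ /mapP[t tts ->]; exact: subring_pred_nat.
  move=> e; rewrite size_map sts => re; rewrite coef_sum.
  apply: (submod_pred_sum (pf_submod fa _)) => j _; rewrite coefCM.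
  have [je|ej] := ltnP j e.
    rewrite [_`_e]nth_default ?sff // mulr0; exact: (submod_pred0 (pf_submod fa _)).
  rewrite mulrC; apply: (submod_predM (pf_submod fa _)) => //.
  have N0 : (0 < T ^_ (T - j))%N by rewrite ffact_gt0 leq_subr.
  (* Here [j >= e >= 2 r]. The factor [T! / j!] has degree [v - logn p j!] and [d j] has degree [j];
     as [logn p j!] is at most [j / 2], the total is at least [r + v]. *)
  apply: (pf_le fa) (pfM fa (pf_natr fa N0) (ad j)) => //.
  have jT : (j <= T)%N by rewrite -ltnS.
  have vE : v = (logn p (T ^_ (T - j)) + logn p j`!)%N.
    rewrite /v -[T`!](ffact_fact (leq_subr j T)) subKn //.
    by rewrite lognM ?fact_gt0.
  have := logn_fact_half j (pf_prime fa) (pf_odd fa); rewrite vE.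
  by move: re ej; clear; lia.
have fx : (T`!)%:R * f x = R.[x%:R] by rewrite RE // leq_maxl.
apply: (pf_natr_cancel fa (fact_gt0 T)); first exact: (nice_val (nf 0%N)).
rewrite fx RQ hornerM; apply: (submod_predM (pf_submod fa _)).
  rewrite horner_prod big_seq; elim/big_ind: _ => //.
  - exact: subring_pred1.
  - by move=> ? ?; exact: (submod_predM (pf_submod fa 0)).
  move=> _ /mapP[t tts ->]; rewrite hornerXsubC.
  by apply: (pfB fa); exact: subring_pred_nat.
rewrite horner_coef; apply: (submod_pred_sum (pf_submod fa _)) => i _.
rewrite mulrC; apply: (submod_predM (pf_submod fa _)) => //.
by apply: subring_predX => //; exact: subring_pred_nat.
Qed.

End Nice.

(** * Transition matrices *)

Definition eval_mx (k : fieldType) n (A : 'M[{poly k}]_n) (i : nat) : 'M[k]_n :=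
  map_mx (horner_eval i%:R) A.

(** This is [A(x + l - 1) ... A(x)], length before starting point; [transition A x 0] is the
    fundamental solution at [x]. *)
Fixpoint transition (k : fieldType) n (A : 'M[{poly k}]_n) (l x : nat) : 'M[k]_n :=
  if l is l'.+1 then eval_mx A (x + l') *m transition A l' x else 1%:M.

Lemma transitionD (k : fieldType) n (A : 'M[{poly k}]_n) l m x :
  transition A (l + m) x = transition A m (x + l) *m transition A l x.
Proof.
elim: m => [|m IHm]; first by rewrite addn0 mul1mx.
by rewrite addnS /= IHm mulmxA addnA.
Qed.

Lemma pigeonhole_nat (T : finType) (f : nat -> T) :
  exists i j, (i < j)%N /\ f i = f j.
Proof.
pose g (i : 'I_(#|T|.+1)) := f i.
have /injectivePn[i [j ij gij]] : ~~ injectiveb g.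
  by apply/negP => /injectiveP/leq_card; rewrite card_ord ltnn.
by have [lt|lt|/val_inj E] := ltngtP i j; [exists i, j|exists j, i|rewrite E eqxx in ij].
Qed.

Section Dynamics.
Variables (k : fieldType) (p : nat) (a : nat -> k -> Prop).
Hypothesis fa : pfiltration p a.

Definition entries_in (J : k -> Prop) n (X : 'M[k]_n) := forall i j, J (X i j).

Section Entries.
Variables (n : nat) (m : nat).
Implicit Types X Y : 'M[k]_n.
Let hJ := pf_submod fa m.

Lemma entries_inB X Y : entries_in (a m) X -> entries_in (a m) Y ->
  entries_in (a m) (X - Y).
Proof. by move=> aX aY i j; rewrite !mxE; exact: (pfB fa). Qed.

Lemma entries_inD X Y : entries_in (a m) X -> entries_in (a m) Y ->
  entries_in (a m) (X + Y).
Proof. by move=> aX aY i j; rewrite !mxE; exact: (submod_predD hJ). Qed.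

Lemma entries_inMl X Y : entries_in (a 0%N) X -> entries_in (a m) Y ->
  entries_in (a m) (X *m Y).
Proof.
move=> aX aY i j; rewrite mxE; apply: (submod_pred_sum hJ) => l _.
exact: (submod_predM hJ).
Qed.

Lemma entries_inMr X Y : entries_in (a m) X -> entries_in (a 0%N) Y ->
  entries_in (a m) (X *m Y).
Proof.
move=> aX aY i j; rewrite mxE; apply: (submod_pred_sum hJ) => l _.
by rewrite mulrC; exact: (submod_predM hJ).
Qed.

End Entries.

Lemma entries_in1 n : entries_in (a 0%N) (1%:M : 'M[k]_n).
Proof. by move=> i j; rewrite mxE; exact: subring_pred_nat (pf_subring fa) _. Qed.

Section Matrix.
Variables (n : nat) (A A' : 'M[{poly k}]_n).
Hypotheses (aA : forall i j, coefs_in (a 0%N) (A i j))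
           (aA' : forall i j, coefs_in (a 0%N) (A' i j)) (AA' : A *m A' = 1%:M).
Let aS := pf_subring fa.

Lemma eval_mx_in (B : 'M[{poly k}]_n) x : (forall i j, coefs_in (a 0%N) (B i j)) ->
  entries_in (a 0%N) (eval_mx B x).
Proof.
move=> aB i j; rewrite mxE /horner_eval; apply: (coefs_in_horner aS) => //.
exact: subring_pred_nat.
Qed.

Lemma transition_in l x : entries_in (a 0%N) (transition A l x).
Proof.
elim: l => [|l IHl] /=; first exact: entries_in1.
by apply: entries_inMl => //; exact: eval_mx_in.
Qed.

Lemma transition_inverse l x :
  exists2 V, entries_in (a 0%N) V & transition A l x *m V = 1%:M.
Proof.
elim: l => [|l [V aV VE]] /=.
  by exists 1%:M; [exact: entries_in1|rewrite mulmx1].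
exists (V *m eval_mx A' (x + l)).
  by apply: entries_inMl => //; exact: eval_mx_in.
by rewrite mulmxA -(mulmxA (eval_mx _ _)) VE mulmx1 -map_mxM AA' map_mx1.
Qed.

Lemma transition_cancel m l x (X : 'M[k]_n) :
  entries_in (a m) (X *m transition A l x) -> entries_in (a m) X.
Proof.
have [V aV VE] := transition_inverse l x.
by move=> /entries_inMr/(_ aV); rewrite -mulmxA VE mulmx1.
Qed.

Lemma horner_congr (q : {poly k}) x e : coefs_in (a 0%N) q ->
  a 1%N (q.[(x + p * e)%:R] - q.[x%:R]).
Proof.
move=> aq; rewrite !horner_coef -sumrB.
apply: (submod_pred_sum (pf_submod fa 1)) => i _; rewrite -mulrBr.
apply: (submod_predM (pf_submod fa 1)) => //.
rewrite subrXX natrD addrAC subrr add0r natrM -mulrA mulrC.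
apply: (submod_predM (pf_submod fa 1)); last exact: pfp fa.
apply: (submod_predM (pf_submod fa 0)); first exact: subring_pred_nat.
apply: (submod_pred_sum (pf_submod fa 0)) => j _; rewrite -natrM -natrD -!natrX -natrM.
exact: (subring_pred_nat aS).
Qed.

Lemma transition_congr l x e :
  entries_in (a 1%N) (transition A l (x + p * e) - transition A l x).
Proof.
elim: l => [|l IHl] /=.
  by rewrite subrr => i j; rewrite mxE; exact: (submod_pred0 (pf_submod fa 1)).
have -> : eval_mx A (x + p * e + l) *m transition A l (x + p * e) -
    eval_mx A (x + l) *m transition A l x =
  (eval_mx A (x + l + p * e) - eval_mx A (x + l)) *m transition A l (x + p * e) +
  eval_mx A (x + l) *m (transition A l (x + p * e) - transition A l x).
  by rewrite addnAC mulmxBl mulmxBr addrA subrK.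
apply: entries_inD; last by apply: entries_inMl => //; exact: eval_mx_in.
apply: entries_inMr; last exact: transition_in.
by move=> i j; rewrite !mxE /horner_eval; exact: horner_congr.
Qed.

(** Modulo [a 1] only finitely many matrices occur at multiples of [p ^ 2], so two agree, and
    cancelling the earlier one leaves the identity. The square of [p] provides the weight two of the
    progressions modulo [M]. *)
Lemma transition_period : exists M, [/\ (0 < M)%N, (p ^ 2 %| M)%N &
  forall x, entries_in (a 1%N) (transition A M x - 1%:M)].
Proof.
have [rs rsP] := pf_fin fa.
have /boolp.choice[f fP] l : exists f : {ffun 'I_n * 'I_n -> 'I_(size rs)},
    forall i j, a 1%N (transition A (p ^ 2 * l) 0 i j - nth 0 rs (f (i, j))).
  have /fin_all_exists[f fP] (ij : 'I_n * 'I_n) : exists t : 'I_(size rs),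
      a 1%N (transition A (p ^ 2 * l) 0 ij.1 ij.2 - nth 0 rs t).
    have [t /(nthP 0)[s srs <-] at1] := rsP _ (@transition_in (p ^ 2 * l) 0 ij.1 ij.2).
    by exists (Ordinal srs).
  by exists (finfun f) => i j; rewrite ffunE; exact: fP (i, j).
have [l1 [l2 [l12 fE]]] := pigeonhole_nat f.
have p0 : (0 < p)%N := prime_gt0 (pf_prime fa).
pose M := (p ^ 2 * (l2 - l1))%N; exists M; split.
- by rewrite muln_gt0 expn_gt0 p0 subn_gt0.
- exact: dvdn_mulr.
have H : entries_in (a 1%N) (transition A M (p ^ 2 * l1) - 1%:M).
  apply: (@transition_cancel _ (p ^ 2 * l1) 0); rewrite mulmxBl mul1mx.
  rewrite -[X in transition A M X]add0n -transitionD /M -mulnDr subnKC ?(ltnW l12) //.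
  move=> i j; rewrite !mxE.
  have -> : transition A (p ^ 2 * l2) 0 i j - transition A (p ^ 2 * l1) 0 i j =
    (transition A (p ^ 2 * l2) 0 i j - nth 0 rs (f l2 (i, j))) -
    (transition A (p ^ 2 * l1) 0 i j - nth 0 rs (f l1 (i, j))) by rewrite fE; ring.
  exact: (pfB fa).
(* The start [p ^ 2 * l1] is a multiple of [p], so it may be replaced by 0. *)
have {}H : entries_in (a 1%N) (transition A M 0 - 1%:M).
  have := entries_inB H (transition_congr M 0 (p * l1)).
  by rewrite add0n mulnA mulnn opprB addrC addrA subrK.
(* The [x + M] steps from 0 are split in both orders, which relates the start [x] to the start 0;
   [p %| M] identifies [transition A x M] with [transition A x 0] modulo [a 1]. *)
move=> x; apply: (@transition_cancel _ x 0); rewrite mulmxBl mul1mx.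
rewrite -[X in transition A M X]add0n -transitionD addnC transitionD.
have -> : transition A x (0 + M) *m transition A M 0 - transition A x 0 =
  transition A x (0 + M) *m (transition A M 0 - 1%:M) +
  (transition A x (0 + M) - transition A x 0).
  by rewrite mulmxBr mulmx1 addrA subrK.
apply: entries_inD; first by apply: entries_inMl => //; exact: transition_in.
by rewrite /M -mulnn -mulnA; exact: transition_congr.
Qed.

Section Period.
Variable M : nat.
Hypotheses (pM : (p ^ 2 %| M)%N)
  (M1 : forall x, entries_in (a 1%N) (transition A M x - 1%:M)).

Lemma nice_progression w m j : (w <= 2)%N ->
  nice a w m 0 (fun i => (j + M * i)%:R).
Proof.
move=> w2; case: m => [|m]; split=> //; try by move=> i; exact: subring_pred_nat.
rewrite [fdiff _](_ : _ = fun=> M%:R).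
  apply: (nice_cst fa); apply: (pf_le fa w2).
  have [e ->] := dvdnP pM; rewrite natrM natrX.
  apply: (submod_predM (pf_submod fa 2)); first exact: subring_pred_nat.
  exact: (pfpX fa 2).
by apply: funext => i; rewrite /fdiff mulnS addnA [(j + M)%N]addnC -addnA natrD addrK.
Qed.

(** At fixed length the entries are polynomials over [a 0] in the starting point, so they inherit
    weight two from the progression. *)
Lemma nice_transition2 m l j u v :
  nice a 2 m 0 (fun i => transition A l (j + M * i) u v).
Proof.
elim: l u v => [|l IHl] u v /=.
  by apply: (nice_cst fa); exact: entries_in1.
rewrite [fun i => _](_ : _ = fun i => \sum_s
    (A u s).[(j + l + M * i)%:R] * transition A l (j + M * i) s v); last first.
  by apply: funext => i; rewrite mxE; apply: eq_bigr => s _; rewrite mxE /horner_eval addnAC.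
apply: (nice_sum fa) => s; apply: (nice_mul fa (j := 0) (l := 0)) => //.
rewrite [fun i => _](_ : _ = fun i => \sum_(t < size (A u s))
    (A u s)`_t * (j + l + M * i)%:R ^+ t); last first.
  by apply: funext => i; rewrite horner_coef.
apply: (nice_sum fa) => t; apply: (nice_mul fa (j := 0) (l := 0)).
  apply: (nice_cst fa); exact: aA.
elim: (t : nat) => [|e IHe].
  rewrite [fun i => _](_ : _ = fun=> 1); first by apply: (nice_cst fa); exact: pf1 fa.
  by apply: funext => i; rewrite expr0.
rewrite [fun i => _](_ : _ = fun i => (j + l + M * i)%:R * (j + l + M * i)%:R ^+ e).
  by apply: (nice_mul fa (j := 0) (l := 0)) => //; exact: nice_progression.
by apply: funext => i; rewrite exprS.
Qed.

(* Here the weight-two estimate is spent: the increment of [C = transition A M]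
   has weight two, while [C - 1] itself only lies in [a 1]. *)
Lemma nice_transition_sub1 m j u v :
  nice a 1 m 1 (fun i => (transition A M (j + M * i) - 1%:M) u v).
Proof.
case: m => [|m]; split=> //; try by move=> i; exact: M1.
apply: (@nice_weaken _ _ _ fa 2 1 m 2) => //.
have [_] := nice_transition2 m.+1 M j u v; rewrite add0n.
by congr nice; apply: funext => i; rewrite /fdiff !mxE; ring.
Qed.

(** Along a class modulo [M] the difference of the fundamental matrix is [C - 1] times itself, with
    [C] the transition of length [M]; the factor [C - 1] supplies one unit of weight at each
    depth. *)
Lemma nice_transition m j u v :
  nice a 1 m 0 (fun i => transition A (j + M * i) 0 u v).
Proof.
elim: m u v => [|m IHm] u v; split=> //; try by move=> i; exact: transition_in.
rewrite [fdiff _](_ : _ = fun i => \sum_s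
    (transition A M (j + M * i) - 1%:M) u s * transition A (j + M * i) 0 s v).
  apply: (nice_sum fa) => s; apply: (nice_mul fa (j := 1) (l := 0)) => //.
  exact: nice_transition_sub1.
apply: funext => i; rewrite /fdiff mulnS addnCA addnC transitionD add0n.
set P := transition A M _; set Q := transition A _ 0.
transitivity (((P - 1%:M) *m Q) u v); last by rewrite mxE.
by rewrite mulmxBl mul1mx [RHS]mxE [X in _ = _ + X]mxE.
Qed.

End Period.
End Matrix.
End Dynamics.

(** * Elimination of scalars outside the filtered subring *)

Section Span.
Variables (k : fieldType) (p : nat) (a : nat -> k -> Prop).
Hypotheses (chk : [pchar k] =i pred0) (fa : pfiltration p a).
Variable M : nat.
Implicit Types f g w : nat -> k.

Definition class_nice w := forall j m, nice a 1 m 0 (fun i => w (j + M * i)%N).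

Definition class_span f := exists (I : finType) (b : I -> k) (w : I -> nat -> k),
  (forall i, class_nice (w i)) /\ forall x, f x = \sum_i b i * w i x.

Lemma class_nice_mul f g : class_nice f -> class_nice g ->
  class_nice (fun x => f x * g x).
Proof.
move=> nf ng j m.
exact: (nice_mul fa (j := 0) (l := 0) (nf j m) (ng j m)).
Qed.

Lemma class_nice_cst x : a 0%N x -> class_nice (fun=> x).
Proof. by move=> ax j m; apply: (nice_cst fa). Qed.

Lemma class_nice_sub f g : class_nice f -> class_nice g ->
  class_nice (fun x => f x - g x).
Proof. by move=> nf ng j m; exact: (nice_sub fa (nf j m) (ng j m)). Qed.

Lemma class_span_nice f : class_nice f -> class_span f.
Proof.
move=> nf; exists 'I_1, (fun=> 1), (fun=> f); split=> // x.
by rewrite big_ord1 mul1r.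
Qed.

Lemma class_span_scale c f : class_span f -> class_span (fun x => c * f x).
Proof.
move=> [I [b [w [nw fE]]]]; exists I, (fun i => c * b i), w; split=> // x.
by rewrite fE mulr_sumr; apply: eq_bigr => i _; rewrite mulrA.
Qed.

Lemma class_span_add f g : class_span f -> class_span g ->
  class_span (fun x => f x + g x).
Proof.
move=> [I [b [w [nw fE]]]] [J [c [v [nv gE]]]].
exists (I + J)%type, (fun z => match z with inl i => b i | inr j => c j end),
  (fun z => match z with inl i => w i | inr j => v j end); split; first by case.
by move=> x; rewrite big_sumType /= fE gE.
Qed.

Lemma class_span_mul f g : class_span f -> class_span g ->
  class_span (fun x => f x * g x).
Proof.
move=> [I [b [w [nw fE]]]] [J [c [v [nv gE]]]].
exists (I * J)%type, (fun z => b z.1 * c z.2), (fun z x => w z.1 x * v z.2 x); split.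
  by move=> [i j]; exact: class_nice_mul.
move=> x; rewrite fE gE big_distrlr pair_big /=; apply: eq_bigr => -[i j] _ /=.
by rewrite mulrACA.
Qed.

(* The scalars [b] are arbitrary elements of [k]: linear relations over [a 0]
   between them are used to eliminate terms, and once there are none left every
   [w i] vanishes wherever [f] does. *)
Lemma class_span_zeros f j : class_span f ->
    (forall N, exists2 i, (N <= i)%N & f (j + M * i)%N = 0) ->
  forall i, f (j + M * i)%N = 0.
Proof.
move=> [I [b [w [nw fE]]]].
have {}fE x : f x = \sum_(i in [set: I]) b i * w i x.
  by rewrite fE; apply: eq_bigl => i; rewrite inE.
move: [set: I] fE => B; have [m] := ubnP #|B|.
elim: m B f w nw => // m IHm B f w nw Bm fE inf i.
have [indep|] := pselect (forall s : I -> k, (forall t, a 0%N (s t)) ->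
    \sum_(t in B) b t * s t = 0 -> forall t, t \in B -> s t = 0).
  rewrite fE big1 // => t tB; rewrite (_ : w t _ = 0) ?mulr0 //.
  move: i; apply: (strassmann fa chk (nw t j)) => N.
  have [i Ni fi] := inf N; exists i => //.
  apply: (indep (fun t => w t (j + M * i)%N)) => [u||//]; last by rewrite -fE.
  exact: (nice_val (nw u j 0%N) i).
move=> /existsNP[s /not_implyP[as_ /not_implyP[sb /existsNP[r /not_implyP[rB /eqP sr]]]]].
suff /eqP : s r * f (j + M * i)%N = 0 by rewrite mulf_eq0 (negPf sr) => /eqP.
apply: (IHm (B :\ r) (fun x => s r * f x) (fun t x => s r * w t x - s t * w r x)).
- move=> t; apply: class_nice_sub; apply: class_nice_mul => //; exact: (class_nice_cst).
- by move: Bm; rewrite (cardsD1 r B) rB ltnS.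
- move=> x; transitivity (s r * f x - w r x * \sum_(t in B) b t * s t).
    by rewrite sb mulr0 subr0.
  rewrite fE !mulr_sumr -sumrB (bigD1 r) //= [X in X + _](_ : _ = 0) ?add0r; last by ring.
  by apply: eq_big => [t|t _]; [rewrite !inE andbC|ring].
- by move=> N; have [t Nt ft] := inf N; exists t => //; rewrite ft mulr0.
Qed.

End Span.

(** * The Skolem-Mahler-Lech dichotomy *)

Section Dichotomy.
Variables (k : fieldType).
Hypothesis chk : [pchar k] =i pred0.

Definition class_indicator (M j : nat) : Seq k :=
  seq_class (fun x => (x == j %[mod M])%:R).

(** The filtration is built from the coefficients of [A] and [A'] alone, so [M] is fixed before [u].
    Up to a polynomial denominator, [u] is a class span, hence on each class it vanishes or has
    finitely many zeros. *)
Lemma unit_adjoin_dichotomy n (A A' : 'M[{poly k}]_n) : A *m A' = 1%:M ->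
  exists2 M, (0 < M)%N & forall u : Seq k,
    adjoin (ratfun_seq chk)
      (fun ij : 'I_n * 'I_n => seq_class (fun x => transition A x 0 ij.1 ij.2)) u ->
    forall j, u * class_indicator M j = 0 \/
      exists t, u * t * class_indicator M j = class_indicator M j.
Proof.
move=> AA'.
pose X := flatten [seq (A ij.1 ij.2 : seq k) ++ (A' ij.1 ij.2 : seq k) | ij : 'I_n * 'I_n].
have [p [a [fa aX]]] := exists_pfiltration chk X.
have aS := pf_subring fa.
have aP (q : {poly k}) : {subset (q : seq k) <= X} -> coefs_in (a 0%N) q.
  move=> qX i; have [iq|qi] := ltnP i (size q).
    by apply/aX/qX/mem_nth.
  by rewrite nth_default //; exact: (submod_pred0 (pf_submod fa 0)).
have aA i j : coefs_in (a 0%N) (A i j).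
  apply: aP => x xA; apply/flattenP; eexists; first by apply/mapP; exists (i, j); rewrite ?mem_enum.
  by rewrite mem_cat xA.
have aA' i j : coefs_in (a 0%N) (A' i j).
  apply: aP => x xA; apply/flattenP; eexists; first by apply/mapP; exists (i, j); rewrite ?mem_enum.
  by rewrite mem_cat xA orbT.
have [M [M0 pM M1]] := transition_period fa aA aA' AA'.
exists M => //.
have span_poly (q : {poly k}) : class_span a M (fun x => q.[x%:R]).
  elim/poly_ind: q => [|q c IHq].
    rewrite (_ : (fun _ => _) = fun=> 0); last by apply: funext => x; rewrite horner0.
    by apply/class_span_nice/(class_nice_cst fa)/(submod_pred0 (pf_submod fa 0)).
  rewrite (_ : (fun _ => _) = fun x => q.[x%:R] * x%:R + c * 1); last first.
    by apply: funext => x; rewrite !hornerE.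
  apply: class_span_add; last first.
    by apply/class_span_scale/class_span_nice/(class_nice_cst fa)/(pf1 fa).
  apply: (class_span_mul fa) => //; apply: class_span_nice => j m.
  exact: (nice_progression fa pM).
move=> u uR.
have [d [f [d0 nf uE]]] : exists d f, [/\ d != 0, class_span a M f &
    u * poly_seq d = seq_class f].
  elim: uR => {u} [x|[i j]|u v _ [d [f [d0 nf uE]]] _ [e [g [e0 ng vE]]]
                          |u v _ [d [f [d0 nf uE]]] _ [e [g [e0 ng vE]]]].
  - exists (\d_(repr x)), (fun i => (\n_(repr x)).[i%:R]); split=> //.
      exact: denom_ratioP.
    by rewrite -(ratfun_seq_poly chk) -rmorphM /= [polyfrac _ _]/(FracField.tofrac _)
        /= frac_numden -[LHS]/(ratfun_seq chk (polyfrac k _)) ratfun_seq_poly.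
  - exists 1, (fun x => transition A x 0 i j); split; rewrite ?oner_neq0 ?rmorph1 ?mulr1 //.
    by apply: class_span_nice => l m; exact: (nice_transition fa aA pM M1).
  - exists (d * e), (fun x => f x * e.[x%:R] + g x * d.[x%:R]); split.
    + exact: mulf_neq0.
    + by apply: class_span_add; apply: (class_span_mul fa).
    + rewrite rmorphM mulrDl mulrA uE mulrCA vE mulrC [X in _ + X]mulrC addrC.
      by rewrite /poly_seq [X in _ + X]mulrC addrC -!rmorphM -rmorphD.
  - exists (d * e), (fun x => f x * g x); split.
    + exact: mulf_neq0.
    + exact: (class_span_mul fa).
    + by rewrite rmorphM mulrACA uE vE -rmorphM.
have dK := poly_seq_fgK chk d0; set d' := seq_class _ in dK.
move=> j; have [inf|] := pselect (forall N, exists2 i, (N <= i)%N & f (j + M * i)%N = 0).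
  left; rewrite -[u]mulr1 -dK mulrA uE mulrAC -rmorphM -[RHS](mul0r d'); congr (_ * _).
  rewrite -(rmorph0 (@seq_class k)); apply/seq_class_eqP; exists j => x jx.
  rewrite -[LHS]/(f x * (x == j %[mod M])%:R).
  case: eqP => [/eqP|_]; last by rewrite mulr0.
  rewrite eqn_mod_dvd // => /dvdnP[e xE].
  have {1}-> : x = (j + M * e)%N by rewrite mulnC -xE subnKC.
  by rewrite (class_span_zeros chk fa nf inf) mul0r.
move=> /existsNP[N Ninf]; right.
(* At early zeros of [f] the field inverse is 0, which is harmless: from [j + M * N] on, [f] has no
   zeros on the class. *)
exists (poly_seq d * seq_class (fun x => (f x)^-1)).
rewrite mulrA uE /class_indicator -!rmorphM; apply/seq_class_eqP; exists (j + M * N)%N => x Nx.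
rewrite -[LHS]/(f x * (f x)^-1 * (x == j %[mod M])%:R).
case: eqP => [/eqP xj|_]; last by rewrite mulr0.
have jx : (j <= x)%N by apply: leq_trans Nx; exact: leq_addr.
rewrite eqn_mod_dvd // in xj; have /dvdnP[e xE] := xj.
have {xE}xE : x = (j + M * e)%N by rewrite mulnC -xE subnKC.
rewrite mulr1 mulfV //; apply/eqP => fx; apply: Ninf; exists e; last by rewrite -xE.
by move: Nx; rewrite xE leq_add2l leq_pmul2l.
Qed.

End Dichotomy.

(** * Vanishing ideals and idempotents *)

Section Period.
Variable k : fieldType.
Local Notation ind := (class_indicator k).

Lemma class_indicator_mod M i j : i = j %[mod M] -> ind M i = ind M j.
Proof. by rewrite /class_indicator => ->. Qed.

Lemma class_indicator_idem M j : ind M j * ind M j = ind M j.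
Proof.
rewrite /class_indicator -rmorphM; apply/seq_class_eqP; exists 0%N => x _.
rewrite -[LHS]/((x == j %[mod M])%:R * (x == j %[mod M])%:R).
by rewrite -natrM mulnb andbb.
Qed.

Lemma class_indicator_orth M i j : i != j %[mod M] -> ind M i * ind M j = 0.
Proof.
move=> ij; rewrite /class_indicator -rmorphM -(rmorph0 (@seq_class k)).
apply/seq_class_eqP; exists 0%N => x _.
rewrite -[LHS]/((x == i %[mod M])%:R * (x == j %[mod M])%:R).
rewrite -natrM mulnb; case: eqP => //= ->; by rewrite (negPf ij).
Qed.

Lemma sigma_class_indicator M j : sigma (ind M j.+1) = ind M j.
Proof.
rewrite /class_indicator sigma_seq_class; congr seq_class; apply: funext => x.
by rewrite -addn1 -[j.+1]addn1 eqn_modDr.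
Qed.

Lemma sigma_seq_inj : injective (sigma : Seq k -> Seq k).
Proof.
move=> x y; have [f ->] := seq_class_surj x; have [g ->] := seq_class_surj y.
rewrite !sigma_seq_class => /seq_class_eqP[N fg]; apply/seq_class_eqP.
by exists N.+1 => -[//|i] /fg.
Qed.

Lemma class_indicator_neq0 M j : (0 < M)%N -> ind M j != 0.
Proof.
move=> M0; apply/eqP; rewrite -(rmorph0 (@seq_class k)) => /seq_class_eqP[N].
have NM : (N <= j + M * N)%N by rewrite (leq_trans (leq_pmull N M0)) // leq_addl.
move=> /(_ _ NM); rewrite [(j + _)%N]addnC [(M * N)%N]mulnC modnMDl eqxx => /eqP.
by rewrite oner_eq0.
Qed.

Lemma class_indicator_split l M j : (0 < M)%N -> (l %| M)%N ->
  ind l j = \sum_(i < M | i == j %[mod l]) ind M i.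
Proof.
move=> M0 lM; rewrite /class_indicator -rmorph_sum; congr seq_class.
apply: funext => x; rewrite fct_sumE.
have xM : (x %% M < M)%N by rewrite ltn_mod.
pose x0 := Ordinal xM.
rewrite (eq_bigr (fun i : 'I_M => (i == x0)%:R)); last first.
  move=> i _; congr (_%:R); rewrite [(i %% M)%N]modn_small // eq_sym.
  by rewrite -val_eqE.
rewrite big_mkcond /= (bigD1 x0) //= big1 ?addr0; last first.
  by move=> i /negPf ->; case: ifP.
by rewrite eqxx modn_dvdm //; case: eqP.
Qed.

Lemma class_indicator_mul l M j : (l %| M)%N -> ind l j * ind M j = ind M j.
Proof.
move=> lM; rewrite /class_indicator -rmorphM; congr seq_class; apply: funext => x.
rewrite -[LHS]/((x == j %[mod l])%:R * (x == j %[mod M])%:R).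
case: (boolP (x == j %[mod M])) => [/eqP E|_]; last by rewrite mulr0.
by rewrite -(modn_dvdm x lM) E modn_dvdm // eqxx mulr1.
Qed.

Variable R : Seq k -> Prop.
Hypotheses (R1 : R 1) (RM : forall u v, R u -> R v -> R (u * v))
  (Rsigma : forall u, R u -> R (sigma u)).
Variable M : nat.
Hypothesis M0 : (0 < M)%N.
Hypothesis dich : forall u, R u -> forall j,
  u * ind M j = 0 \/ exists t, u * t * ind M j = ind M j.

Let vanishing_sub i j := forall u, R u -> u * ind M i = 0 -> u * ind M j = 0.

(** [sigma] preserves [R], lowers the class of an indicator by one and is injective on [Seq k], so
    vanishing may be tested after applying it. *)
Let vsubDr i j t : vanishing_sub i j -> vanishing_sub (i + t) (j + t).
Proof.
elim: t => [|t IHt]; first by rewrite !addn0.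
move=> /IHt{}IHt u Ru; rewrite !addnS => ui.
apply: sigma_seq_inj; rewrite rmorphM sigma_class_indicator rmorph0.
apply: IHt; first exact: Rsigma.
by rewrite -sigma_class_indicator -rmorphM ui rmorph0.
Qed.

(* Inclusions between the ideals of elements vanishing on the classes of [i] and of
   [j] are preserved by shifting [i] and [j], so they force [i = j] modulo the least
   [l] with an inclusion from [0] to [l]; primality of the ideals then yields
   elements supported on a single class mod [l]. *)
Lemma minimal_period : exists2 l, (0 < l)%N &
  (forall u, R u -> forall j,
     u * ind l j = 0 \/ exists t, u * t * ind l j = ind l j) /\
  (forall j, exists v, [/\ R v,
     forall i, i != j %[mod l] -> v * ind l i = 0
     & exists t, v * t * ind l j = ind l j]).
Proof.
have exl : exists l, `[< (0 < l)%N /\ vanishing_sub 0 l >].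
  exists M; apply/asboolP; split=> // u _.
  by rewrite (@class_indicator_mod M M 0) // modnn mod0n.
have [l /asboolP[l0 sub0l] lmin] := ex_minnP exl.
have subl t e : vanishing_sub t (t + e * l).
  elim: e => [|e IHe]; first by rewrite mul0n addn0.
  move=> u Ru /(IHe u Ru); rewrite mulSn addnCA.
  by have := @vsubDr 0 l (t + e * l) sub0l; rewrite add0n; apply.
(* Going [e * (M - 1)] more steps of [l] leads to [t + e * M * l], the class of [t] modulo [M], so
   these inclusions can be reversed. *)
have subl' t e : vanishing_sub (t + e * l) t.
  move=> u Ru /(subl _ (e * M.-1)%N u Ru); rewrite -addnA -mulnDl -mulnS prednK //.
  by rewrite (@class_indicator_mod M _ t) // mulnAC addnC modnMDl.
(* Shifting by [i * (l - 1)] turns [i] into a multiple of [l]. This gives an inclusion from 0 to the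
   remainder of [j + i * (l - 1)] modulo [l], and minimality makes that remainder 0. *)
have submod i j : vanishing_sub i j -> i = j %[mod l].
  move=> ij; have := @vsubDr i j (i * l.-1)%N ij.
  rewrite -mulnS prednK // => H.
  have {}H : vanishing_sub 0 ((j + i * l.-1) %% l).
    move=> u Ru u0; have := subl 0%N i u Ru u0; rewrite add0n => /(H u Ru).
    rewrite {1}(divn_eq (j + i * l.-1) l) addnC; exact: subl'.
  have : (j + i * l.-1)%N = 0 %[mod l].
    rewrite mod0n; apply/eqP; rewrite -leqn0 leqNgt; apply/negP => gt0.
    have : (l <= (j + i * l.-1) %% l)%N by apply: lmin; apply/asboolP.
    by rewrite leqNgt ltn_mod l0.
  move=> E; apply/eqP; rewrite -(eqn_modDr (i * l.-1)) -mulnS prednK // E.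
  by rewrite modnMl mod0n.
have lM : (l %| M)%N.
  have /submod : vanishing_sub 0 M.
    by move=> u _; rewrite (@class_indicator_mod M M 0) // modnn mod0n.
  by rewrite mod0n => /esym/eqP.
have vmod u i j : R u -> i = j %[mod l] -> u * ind M i = 0 -> u * ind M j = 0.
  move=> Ru E; rewrite (divn_eq i l) (divn_eq j l) E => ui.
  by rewrite addnC; apply: subl => //; apply: (subl' _ (i %/ l)%N) => //; rewrite addnC.
have dichl u : R u -> forall j,
     u * ind l j = 0 \/ exists t, u * t * ind l j = ind l j.
  move=> Ru j; rewrite (class_indicator_split j M0 lM).
  have [uj|uj] := pselect (u * ind M j = 0).
    left; rewrite mulr_sumr big1 // => i /eqP/esym ij; exact: vmod ij uj.
  right; have /boolp.choice[t tE] (i : 'I_M) : exists t,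
      i = j %[mod l] -> u * t * ind M i = ind M i.
    have [ui|[t tE]] := dich Ru i; last by exists t.
    by exists 0 => ij; case: uj; exact: vmod ij ui.
  exists (\sum_(i < M | i == j %[mod l]) t i * ind M i).
  have -> : u * (\sum_(i < M | i == j %[mod l]) t i * ind M i) =
      \sum_(i < M | i == j %[mod l]) ind M i.
    by rewrite mulr_sumr; apply: eq_bigr => i /eqP ij; rewrite mulrA tE.
  by rewrite -class_indicator_split // class_indicator_idem.
exists l => //; split=> // j.
(* For [i] not congruent to [j] the inclusion fails, so some [w] vanishes on the class of [i] and is
   a unit on that of [j]. The product over these [i] isolates the class of [j]. *)
have /boolp.choice[w wP] i : exists w, R w /\ (i != j %[mod l] ->
    w * ind l i = 0 /\ exists t, w * t * ind l j = ind l j).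
  have [/submod E|] := pselect (vanishing_sub i j).
    by exists 1; split=> //; rewrite E eqxx.
  move=> /existsNP[w /not_implyP[Rw /not_implyP[wi wj]]]; exists w; split=> // _.
  have lift0 x : w * ind l x = 0 -> w * ind M x = 0.
    by move=> E; rewrite -(class_indicator_mul x lM) mulrA E mul0r.
  split; last by have [/lift0|] := dichl w Rw j.
  have [//|[t wt]] := dichl w Rw i.
  have E : ind M i = w * t * ind l i * ind M i by rewrite wt class_indicator_mul.
  have {}E : ind M i = t * ind l i * (w * ind M i) by rewrite {1}E; ring.
  by have := class_indicator_neq0 i M0; rewrite E wi mulr0 eqxx.
exists (\prod_(i < l | i != j %[mod l]) w i); split.
- by elim/big_ind: _ => // i _; exact: (wP i).1.
- move=> i ij; have il : (i %% l < l)%N by rewrite ltn_mod.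
  rewrite (bigD1 (Ordinal il)) /=; last by rewrite modn_mod.
  rewrite -(@class_indicator_mod l (i %% l) i) ?modn_mod // mulrAC.
  by have [|-> _] := (wP (i %% l)%N).2; rewrite ?modn_mod // mul0r.
elim/big_ind: _ => [|u v [t ut] [s vs]|i /(wP i).2[]//].
  by exists 1; rewrite !mul1r.
exists (t * s); have -> : u * v * (t * s) * ind l j = u * t * (v * s * ind l j) by ring.
by rewrite vs ut.
Qed.

End Period.

(** * The Picard-Vessiot extension *)

Section AdjoinClosure.
Variables (K L : comNzRingType) (f : {rmorphism K -> L}) (I : Type) (y : I -> L).
Local Notation B := (adjoin f y).

Lemma adjoin_one : B 1.
Proof. by rewrite -(rmorph1 f); exact: adj_base. Qed.

Lemma adjoin_zero : B 0.
Proof. by rewrite -(rmorph0 f); exact: adj_base. Qed.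

Lemma adjoin_opp u : B u -> B (- u).
Proof.
by move=> Bu; rewrite -mulN1r -(rmorphN1 f); apply: adj_mul => //; exact: adj_base.
Qed.

Lemma adjoin_sum (J : Type) (r : seq J) (P : pred J) (F : J -> L) :
  (forall i, P i -> B (F i)) -> B (\sum_(i <- r | P i) F i).
Proof. by move=> BF; elim/big_ind: _ => //; [exact: adjoin_zero|exact: adj_add]. Qed.

Lemma adjoin_prod (J : Type) (r : seq J) (P : pred J) (F : J -> L) :
  (forall i, P i -> B (F i)) -> B (\prod_(i <- r | P i) F i).
Proof. by move=> BF; elim/big_ind: _ => //; [exact: adjoin_one|exact: adj_mul]. Qed.

Lemma adjoin_det n (Y : 'M[L]_n) : (forall i j, B (Y i j)) -> B (\det Y).
Proof.
move=> BY; apply: adjoin_sum => s _; apply: adj_mul; last exact: adjoin_prod.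
elim: {s}(nat_of_bool _) => [|m IHm]; first by rewrite expr0; exact: adjoin_one.
by rewrite exprS; apply: adj_mul => //; exact/adjoin_opp/adjoin_one.
Qed.

End AdjoinClosure.

Section SeqMatrix.
Variables (k : fieldType) (n : nat).
Implicit Types F G : nat -> 'M[k]_n.

Definition seq_mx F : 'M[Seq k]_n := \matrix_(i, j) seq_class (fun x => F x i j).

Lemma seq_mxM F G : seq_mx F *m seq_mx G = seq_mx (fun x => F x *m G x).
Proof.
apply/matrixP => i j; rewrite !mxE.
under eq_bigr => s _ do rewrite !mxE -rmorphM.
rewrite -rmorph_sum; congr seq_class; apply: funext => x.
by rewrite fct_sumE mxE.
Qed.

Lemma seq_mx1 : seq_mx (fun=> 1%:M) = 1%:M.
Proof.
apply/matrixP => i j; rewrite !mxE -(rmorph_nat (@seq_class k)).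
by congr seq_class; apply: funext => x; case: eqP.
Qed.

Lemma sigma_seq_mx F : map_mx sigma (seq_mx F) = seq_mx (fun x => F x.+1).
Proof. by apply/matrixP => i j; rewrite !mxE sigma_seq_class. Qed.

Lemma ratfun_seq_mx (chk : [pchar k] =i pred0) (A : 'M[{poly k}]_n) :
  map_mx (ratfun_seq chk) (map_mx (polyfrac k) A) = seq_mx (eval_mx A).
Proof.
apply/matrixP => i j; rewrite !mxE ratfun_seq_poly.
by congr seq_class; apply: funext => x; rewrite mxE.
Qed.

End SeqMatrix.

Section PicardVessiot.
Variables (k : fieldType) (chk : [pchar k] =i pred0).
Variables (n : nat) (A A' : 'M[{poly k}]_n).
Hypothesis AA' : A *m A' = 1%:M.

Let Y := seq_mx (fun x => transition A x 0).
Let R : Seq k -> Prop :=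
  adjoin (ratfun_seq chk) (fun ij : 'I_n * 'I_n => Y ij.1 ij.2).

Let sigmaY : map_mx sigma Y = map_mx (ratfun_seq chk) (map_mx (polyfrac k) A) *m Y.
Proof. by rewrite sigma_seq_mx ratfun_seq_mx seq_mxM. Qed.

Let RY i j : R (Y i j).
Proof. exact: (adj_gen _ _ (i, j)). Qed.

Let A_unit : map_mx (polyfrac k) A \in unitmx.
Proof.
have [uA _] := mulmx1_unit AA'.
by rewrite unitmxE det_map_mx; apply: rmorph_unit; rewrite -unitmxE.
Qed.

Let R_sigma u : R u -> R (sigma u).
Proof.
elim=> {u} [a|[i j]|u v _ Ru _ Rv|u v _ Ru _ Rv].
- have := ratfun_seqP chk a; rewrite /= => <-; exact: adj_base.
- have := congr1 (fun X : 'M_n => X i j) sigmaY; rewrite /= mxE => ->.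
  rewrite mxE; apply: adjoin_sum => s _; apply: adj_mul.
    by rewrite mxE; exact: adj_base.
  exact: RY.
- by rewrite rmorphD; exact: adj_add.
- by rewrite rmorphM; exact: adj_mul.
Qed.

Let Y_unit : exists t, \det Y * t = 1.
Proof.
have unitT x : transition A x 0 \in unitmx.
  elim: x => [|x IHx] /=; first exact: unitmx1.
  rewrite unitmx_mul IHx andbT.
  suff /mulmx1_unit[] : eval_mx A (0 + x) *m eval_mx A' (0 + x) = 1%:M by [].
  by rewrite -map_mxM AA' map_mx1.
exists (\det (seq_mx (fun x => invmx (transition A x 0)))).
rewrite -det_mulmx seq_mxM; under [fun x => _]funext => x do rewrite mulmxV //.
by rewrite seq_mx1 det1.
Qed.

(** Denominators are the elements of [R] invertible in [Seq k]. By [nonzerodivisor_unit] they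
    include all nonzerodivisors of [R], so this is the total ring of fractions. *)
Let quot : {pred Seq k} :=
  fun x => `[< exists b s t, [/\ R b, R s, s * t = 1 & x = b * t] >].

Let quot_intro b s t : R b -> R s -> s * t = 1 -> b * t \in quot.
Proof. by move=> Rb Rs st; apply/asboolP; exists b, s, t. Qed.

Let R_quot b : R b -> b \in quot.
Proof.
move=> Rb; rewrite -[b]mulr1; apply: (@quot_intro _ 1); rewrite ?mulr1 //.
exact: adjoin_one.
Qed.

Let quot_inv s t : R s -> s * t = 1 -> t \in quot.
Proof. by move=> Rs st; rewrite -[t]mul1r; apply: quot_intro Rs st; exact: adjoin_one. Qed.

Let quot_subring : subring_closed quot.
Proof.
split; first exact: R_quot (adjoin_one _ _).
- move=> _ _ /asboolP[b [s [t [Rb Rs st ->]]]] /asboolP[b' [s' [t' [Rb' Rs' st' ->]]]].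
  have -> : b * t - b' * t' = (b * s' - b' * s) * (t * t').
    transitivity (b * t * (s' * t') - b' * t' * (s * t)); last by ring.
    by rewrite st st' !mulr1.
  apply: (@quot_intro _ (s * s')).
  + by apply: adj_add; [|apply: adjoin_opp]; exact: adj_mul.
  + exact: adj_mul.
  + by rewrite mulrACA st st' mulr1.
- move=> _ _ /asboolP[b [s [t [Rb Rs st ->]]]] /asboolP[b' [s' [t' [Rb' Rs' st' ->]]]].
  rewrite mulrACA; apply: (@quot_intro _ (s * s')); [exact: adj_mul|exact: adj_mul|].
  by rewrite mulrACA st st' mulr1.
Qed.

Let quot_base (a : ratfun k) : salg_map (Seq_alg chk) a \in quot.
Proof. by apply: R_quot; exact: adj_base. Qed.

Let quot_sigma : {in quot, forall x : Seq k, sigma x \in quot}.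
Proof.
move=> _ /asboolP[b [s [t [Rb Rs st ->]]]]; rewrite rmorphM.
apply: (@quot_intro _ (sigma s)); try exact: R_sigma.
by rewrite -rmorphM st rmorph1.
Qed.

Definition pv_subalg : sigmaSubalg (Seq_alg chk) :=
  @SigmaSubalg _ (Seq_alg chk) quot quot_subring quot_base quot_sigma.

Let L := subalg_alg pv_subalg.
Let inL x (Lx : x \in quot) : L := exist (fun x => x \in subalg_pred pv_subalg) x Lx.

Let L_val_inj (x y : L) : val x = val y -> x = y.
Proof. exact: val_inj. Qed.

Let YL : 'M[L]_n := \matrix_(i, j) inL (R_quot (RY i j)).
Let RL : L -> Prop := adjoin (salg_map L) (fun ij : 'I_n * 'I_n => YL ij.1 ij.2).

Let val_YL : map_mx val YL = Y.
Proof. by apply/matrixP => i j; rewrite !mxE. Qed.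

Let RL_val u : RL u -> R (val u).
Proof.
elim=> {u} [a|[i j]|u v _ Ru _ Rv|u v _ Ru _ Rv].
- exact: adj_base.
- by rewrite mxE; exact: RY.
- by rewrite rmorphD; exact: adj_add.
- by rewrite rmorphM; exact: adj_mul.
Qed.

Let val_RL x : R x -> exists2 u, RL u & val u = x.
Proof.
elim=> {x} [a|[i j]|x y _ [u Ru <-] _ [v Rv <-]|x y _ [u Ru <-] _ [v Rv <-]].
- by exists (salg_map L a) => //; exact: adj_base.
- by exists (YL i j); [exact: (adj_gen _ _ (i, j))|rewrite mxE /= mxE].
- by exists (u + v); [exact: adj_add|exact: rmorphD].
- by exists (u * v); [exact: adj_mul|exact: rmorphM].
Qed.

Let L_inGL : inGL YL.
Proof.
have [t Yt] := Y_unit.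
have Rdet : R (\det Y) by apply: adjoin_det => i j; exact: RY.
pose tL := inL (quot_inv Rdet Yt).
have dt : tL * \det YL = 1.
  apply: L_val_inj; rewrite rmorphM rmorph1 -det_map_mx val_YL mulrC; exact: Yt.
exists (tL *: \adj YL); split.
  by rewrite -scalemxAr mul_mx_adj scale_scalar_mx dt.
by rewrite -scalemxAl mul_adj_mx scale_scalar_mx dt.
Qed.

Let sigmaYL : map_mx sigma YL = map_mx (salg_map L) (map_mx (polyfrac k) A) *m YL.
Proof.
have valA : map_mx val (map_mx (salg_map L) (map_mx (polyfrac k) A)) =
    map_mx (ratfun_seq chk) (map_mx (polyfrac k) A).
  by apply/matrixP => i j; rewrite !mxE.
apply/matrixP => i j; apply: L_val_inj; transitivity (map_mx sigma Y i j).
  by rewrite [in RHS]mxE [X in val X]mxE [YL i j]mxE.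
rewrite sigmaY -valA -val_YL -map_mxM mxE //.
Qed.

(** Already in [Seq k], a class fixed by [sigma] is an eventually constant sequence, which is the
    image of a constant polynomial. *)
Let L_constants (x : L) : sigma x = x <->
  exists a : ratfun k, sigma a = a /\ x = salg_map L a.
Proof.
split=> [sx|[a [sa ->]]]; last by rewrite -salg_mapP sa.
have : sigma (val x) = val x by rewrite -[RHS](congr1 val sx).
have [f fE] := seq_class_surj (val x : Seq k).
rewrite fE sigma_seq_class => /seq_class_eqP[N fN].
exists (polyfrac k (f N)%:P); split.
  by rewrite sigma_polyfrac /shift_poly comp_polyC.
apply: L_val_inj; rewrite fE /= ratfun_seq_poly.
apply/seq_class_eqP; exists N => i; rewrite hornerC.
by move/subnK <-; elim: (i - N)%N => // m IHm; rewrite addSn fN // leq_addl.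
Qed.

Section Idempotents.
Variables (l : nat) (l0 : (0 < l)%N).
Local Notation ind := (class_indicator k).
Hypothesis dich : forall u, R u -> forall j,
  u * ind l j = 0 \/ exists t, u * t * ind l j = ind l j.
Hypothesis support : forall j, exists v, [/\ R v,
  forall i, i != j %[mod l] -> v * ind l i = 0
  & exists t, v * t * ind l j = ind l j].

(* The shift lowers the class of an indicator, hence the reversed numbering. *)
Let E (i : 'I_l) : Seq k := ind l (rev_ord i).+1.

Let E_idem i : E i * E i = E i. Proof. exact: class_indicator_idem. Qed.

Let rev_ordS_mod (i j : 'I_l) : (rev_ord i).+1 = (rev_ord j).+1 %[mod l] -> i = j.
Proof.
move=> /eqP; rewrite -addn1 -[(rev_ord j).+1]addn1 eqn_modDr !modn_small //.
by move=> /eqP/val_inj/rev_ord_inj.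
Qed.

Let E_orth i j : i != j -> E i * E j = 0.
Proof.
by move=> ij; apply: class_indicator_orth; apply: contra ij => /eqP/rev_ordS_mod ->.
Qed.

Let E_sum : \sum_i E i = 1.
Proof.
have -> : 1 = ind 1 0 :> Seq k.
  rewrite -(rmorph1 (@seq_class k)); congr seq_class; apply: funext => x.
  by rewrite modn1.
rewrite (class_indicator_split k 0 l0 (dvd1n l)) (reindex_inj rev_ord_inj) /=.
under [RHS]eq_bigl => i do rewrite !modn1 eqxx.
rewrite /E; under eq_bigr => i _ do rewrite rev_ordK.
(* The indices run from 1 to [l] on one side and from 0 to [l - 1] on the other; [l] and 0 give the
   same class. *)
case: l l0 => // m _; rewrite big_ord_recr [RHS]big_ord_recl addrC /=.
by rewrite (@class_indicator_mod k m.+1 m.+1 0) ?modnn ?mod0n.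
Qed.

Let E_sigma i : sigma (E i) = E (ordS i).
Proof.
rewrite /E sigma_class_indicator; apply: class_indicator_mod => /=.
have := ltn_ord i; rewrite leq_eqVlt => /predU1P[->|il].
  by rewrite subnn modnn subn1 prednK // modnn mod0n.
by rewrite (modn_small il) subnSK.
Qed.

Let E_support i : exists v, [/\ R v, forall j, j != i -> v * E j = 0
  & exists t, v * t * E i = E i].
Proof.
have [v [Rv v0 vt]] := support (rev_ord i).+1; exists v; split=> // j ji.
by apply: v0; apply: contra ji => /eqP/rev_ordS_mod ->.
Qed.

Let decompose x : x = \sum_i x * E i.
Proof. by rewrite -mulr_sumr E_sum mulr1. Qed.

Let unit_of_components u : (forall i, exists t, u * t * E i = E i) ->
  exists t, u * t = 1.
Proof.
move=> /fin_all_exists[t tE]; exists (\sum_i t i * E i).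
by rewrite -E_sum mulr_sumr; apply: eq_bigr => i _; rewrite mulrA tE.
Qed.

(** If [s] vanished on a class, it would annihilate the nonzero element of [R] supported there. By
    the dichotomy it is therefore a unit on every class. *)
Let nonzerodivisor_unit s : nonzerodivisor_in R s -> exists t, s * t = 1.
Proof.
move=> [Rs sreg]; apply: unit_of_components => i.
have [sE|//] := dich Rs (rev_ord i).+1.
have [v [Rv v0 [t vt]]] := E_support i.
have v_eq : v = v * E i.
  by rewrite {1}[v]decompose (bigD1 i) //= big1 ?addr0 // => j /v0.
have /sreg v0' : R v by [].
have {}v0' : v = 0 by apply: v0'; rewrite v_eq mulrCA sE mulr0.
by have := class_indicator_neq0 k (rev_ord i).+1 l0; rewrite -[ind _ _]vt v0' !mul0r eqxx.
Qed.

(* [E i = v_i / (v_0 + ... + v_(l-1))] for [v_i] supported exactly on class [i]. *)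
Let v_sum : exists v : 'I_l -> Seq k, exists2 t, (\sum_i v i) * t = 1 &
  forall i, [/\ R (v i), v i * E i = v i, (\sum_j v j) * E i = v i &
    exists s, v i * s * E i = E i].
Proof.
have /fin_all_exists[v vP] := E_support.
have vE i : v i * E i = v i.
  have [_ v0 _] := vP i.
  by rewrite {2}[v i]decompose (bigD1 i) //= big1 ?addr0 // => j /v0.
have wE i : (\sum_j v j) * E i = v i.
  rewrite mulr_suml (bigD1 i) //= vE big1 ?addr0 // => j ji.
  by have [_ v0 _] := vP j; apply: v0; rewrite eq_sym.
have [t wt] : exists t, (\sum_i v i) * t = 1.
  apply: unit_of_components => i; have [_ _ [t vt]] := vP i; exists t.
  by rewrite mulrAC wE -[RHS]vt [RHS]mulrAC vE.
by exists v, t => // i; have [Rv _ vt] := vP i; split.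
Qed.

Let E_quot i : E i \in quot.
Proof.
have [v [t wt /all_and4[Rv _ wE _]]] := v_sum.
have -> : E i = v i * t.
  by rewrite -wE mulrAC wt mul1r.
by apply: (quot_intro (Rv i) _ wt); apply: adjoin_sum => j _; exact: Rv.
Qed.

Lemma pv_pseudo_field : sigma_pseudo_field L.
Proof.
pose e i : L := inL (E_quot i).
exists l, e; split=> //.
- split=> [i|i j ij]; apply: L_val_inj; rewrite rmorphM /=; first exact: E_idem.
  by rewrite E_orth // rmorph0.
- move=> x; exists [ffun i => e i * x]; split.
    split=> [i|]; first by rewrite ffunE; exists x.
    under eq_bigr => i _ do rewrite ffunE.
    rewrite -mulr_suml; have -> : \sum_i e i = 1; last by rewrite mul1r.
    by apply: L_val_inj; rewrite rmorph_sum rmorph1 /= E_sum.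
  move=> u [uP ->]; apply/ffunP => i; rewrite ffunE mulr_sumr (bigD1 i) //= big1 => [|j ji].
    have [y ->] := uP i; rewrite addr0 mulrA; congr (_ * _).
    by apply: L_val_inj; rewrite rmorphM /= E_idem.
  have [y ->] := uP j; rewrite mulrA; apply: L_val_inj.
  by rewrite 2!rmorphM /= E_orth ?mul0r ?rmorph0 // eq_sym.
- by move=> i; apply: L_val_inj; rewrite /= E_sigma.
move=> i; split.
  apply/eqP => ei0; have /eqP : E i = val (e i) by []; rewrite ei0 rmorph0.
  by rewrite (negPf (class_indicator_neq0 k _ l0)).
move=> _ [x ->] ex0; have /asboolP[b [s [t [Rb Rs st xE]]]] := valP x.
have [v [w vw vP]] := v_sum; have [Rv vE _ [r vr]] := vP i.
have [bE|[q bq]] := dich Rb (rev_ord i).+1.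
  case/eqP: ex0; apply: L_val_inj; rewrite rmorphM rmorph0 /= xE mulrA.
  by rewrite [E i * b]mulrC bE mul0r.
(* [b] may vanish on other classes. The [v j] fill these in, so that [c] lies in [R], is a unit of
   [Seq k] and agrees with [b * v i] on class [i], where the inverse of [x = b / s] becomes
   [s * v i / c]. *)
pose c := b * v i + \sum_(j < l | j != i) v j.
have Rc : R c.
  apply: adj_add; first exact: adj_mul.
  by apply: adjoin_sum => j _; have [] := vP j.
have cE : c * E i = b * v i.
  rewrite /c mulrDl -mulrA vE mulr_suml big1 ?addr0 // => j ji.
  by have [_ <- _ _] := vP j; rewrite -mulrA E_orth ?mulr0.
have [d cd] : exists d, c * d = 1.
  apply: unit_of_components => j; have [->|ji] := eqVneq j i.
    exists (q * r); transitivity (c * E i * (q * r) * E i).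
      by rewrite -[in LHS](E_idem i); ring.
    rewrite cE; transitivity (b * q * E i * (v i * r * E i)).
      by rewrite -[in LHS](E_idem i); ring.
    by rewrite vr [b * q * _]bq E_idem.
  have [_ vjE _ [rj vjr]] := vP j; exists rj; rewrite -[RHS]vjr.
  suff cEj : c * E j = v j by rewrite [LHS]mulrAC cEj [RHS]mulrAC vjE.
  have viEj : v i * E j = 0 by rewrite -vE -mulrA E_orth ?mulr0 // eq_sym.
  rewrite /c mulrDl -mulrA viEj mulr0 add0r.
  rewrite mulr_suml (bigD1 j) //= vjE big1 ?addr0 // => j' /andP[_ j'j].
  by have [_ <- _ _] := vP j'; rewrite -mulrA E_orth ?mulr0.
have dL : d \in quot := quot_inv Rc cd.
exists (e i * (inL (R_quot Rs) * inL (R_quot Rv) * inL dL)).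
  by exists (inL (R_quot Rs) * inL (R_quot Rv) * inL dL).
apply: L_val_inj; rewrite !rmorphM /= xE.
transitivity (b * v i * E i * d * (s * t) * E i); first by ring.
by rewrite -cE st; transitivity (c * d * (E i * E i) * E i); [ring|rewrite cd mul1r !E_idem].
Qed.

Lemma pv_total_fractions : total_fraction_ring RL.
Proof.
split=> [u [Ru ureg]|x].
  have Rv : R (val u) by exact: RL_val.
  have [t ut] : exists t, val u * t = 1.
    apply: nonzerodivisor_unit; split=> // b /val_RL[w Rw <-] uw.
    by rewrite (ureg w Rw) ?rmorph0 //; apply: L_val_inj; rewrite rmorphM rmorph0.
  exists (inL (quot_inv Rv ut)).
  by apply: L_val_inj; rewrite rmorphM rmorph1.
have /asboolP[b [s [t [Rb Rs st xE]]]] := valP x.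
have [bL RbL bE] := val_RL Rb; have [sL RsL sE] := val_RL Rs.
have stL : sL * inL (quot_inv Rs st) = 1.
  by apply: L_val_inj; rewrite rmorphM rmorph1 /= sE.
exists bL, sL, (inL (quot_inv Rs st)); split=> //.
  split=> // c _ sc; rewrite -[c]mul1r -stL mulrAC sc mul0r //.
by apply: L_val_inj; rewrite rmorphM /= bE.
Qed.

End Idempotents.

Lemma pv_subalgP : Picard_Vessiot (map_mx (polyfrac k) A) L.
Proof.
have [M M0 dich] := unit_adjoin_dichotomy chk AA'.
have YE : (fun ij : 'I_n * 'I_n => seq_class (fun x => transition A x 0 ij.1 ij.2)) =
    (fun ij : 'I_n * 'I_n => Y ij.1 ij.2) by apply: funext => ij; rewrite mxE.
rewrite YE in dich.
have [l l0 [dichl supp]] := minimal_period (adjoin_one _ _) (@adj_mul _ _ _ _ _) R_sigma M0 dich.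
split.
- exact: A_unit.
- exact: pv_pseudo_field l0 dichl supp.
- exists YL; split; [exact: L_inGL|exact: sigmaYL|].
  exact: pv_total_fractions l0 dichl supp.
- exact: L_constants.
Qed.

End PicardVessiot.

Theorem corollary3p4 (k : fieldType) (chk : [pchar k] =i pred0)
    (n : nat) (n_ge1 : (1 <= n)%N) (A : 'M[{poly k}]_n)
    (detA : exists2 c : k, c != 0 & \det A = c%:P) :
  exists L : sigmaSubalg (Seq_alg chk),
    Picard_Vessiot (map_mx (polyfrac k) A) (subalg_alg L).
Proof.
have [c c0 cE] := detA.
(* A nonzero constant determinant makes the inverse of [A] polynomial, which is what the
   construction takes as [A']. *)
have AA' : A *m (c^-1%:P *: \adj A) = 1%:M.
  by rewrite -scalemxAr mul_mx_adj cE scale_scalar_mx -polyCM mulVf.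
by exists (pv_subalg chk A); exact: pv_subalgP AA'.
Qed.
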